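(* Let $\mathfrak{M}$ be a prime von Neumann algebra, let $A\in\mathfrak{M}$ be a nonzero positive well-supported element, and let $S,T\in\mathfrak{M}^A$. Then $r_A(SX)\le r_A(TX)$ for all $X\in\mathfrak{M}^A$ if and only if there exists a scalar $\alpha\in\mathbb{C}$ such that $|\alpha|\le1$ and $AS=\alpha AT$.
   Context: $\mathfrak{M}$ acts on a complex Hilbert space $\mathcal{H}$ and contains the identity $I$. $\mathfrak{M}$ is prime if for $a,b\in\mathfrak{M}$, $a\mathfrak{M}b=\{0\}$ implies $a=0$ or $b=0$. The positive element $A$ is called well-supported if $\sigma(A)\setminus\{0\}$ is closed, equivalently $\sigma(A)\subseteq\{0\}\cup[\alpha_0,\infty)$ for some $\alpha_0>0$. For $h\in\mathcal{H}$ put $\|h\|_A=\sqrt{\langle Ah,h\rangle}$, for $T\in\mathfrak{M}$ put $\|T\|_A=\sup\{\|Th\|_A:\|h\|_A=1\}$, and set $\mathfrak{M}^A=\{T\in\mathfrak{M}:\|T\|_A<\infty\}$ (a subalgebra of $\mathfrak{M}$). $T\in\mathfrak{M}^A$ is $A$-invertible in $\mathfrak{M}^A$ if there is $S\in\mathfrak{M}^A$ with $ATS=AST=A$; the $A$-spectrum is $\sigma_A(T)=\{\lambda\in\mathbb{C}:\lambda I-T\text{ is not }A\text{-invertible in }\mathfrak{M}^A\}$ and the $A$-spectral radius is $r_A(T)=\sup\{|\lambda|:\lambda\in\sigma_A(T)\}$. *)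

(* Defs.v *)
From HB Require Import structures.
From mathcomp Require Import all_boot all_order all_algebra.
From mathcomp Require Import all_classical all_reals all_analysis.
From mathcomp Require Import complex.

Set Implicit Arguments.
Unset Strict Implicit.
Unset Printing Implicit Defensive.
Import Order.TTheory GRing.Theory Num.Theory.
Import numFieldNormedType.Exports.
Local Open Scope classical_set_scope.
Local Open Scope ring_scope.

Section Operators.
Context {R : realType} {H : completeNormedModType R[i]}.

(* The norm of [H] is the one induced by [dot], so that [H], being complete,
   is a Hilbert space with inner product [dot] (linear in its first argument). *)
Definition induces_norm (dot : {dot H for Num.conj}) :=
  forall x : H, `|x| ^+ 2 = dot x x.

Definition bounded_operator (T : H -> H) := linear T /\ continuous T.

Definition adjoint_of (dot : {dot H for Num.conj}) (T T' : H -> H) :=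
  forall x y, dot (T x) y = dot x (T' y).

(* The weak operator topology is initial for the map sending an operator [T]
   to the function [(x, y) |-> <T x, y>], under pointwise convergence. *)
Definition matrix_coeffs (dot : {dot H for Num.conj}) (T : H -> H) :
  {ptws (H * H)%type -> R[i]^o} := fun p => dot (T p.1) p.2.

Definition wot (dot : {dot H for Num.conj}) : topologicalType :=
  initial_topology (matrix_coeffs dot).

(* Closedness is relative to the bounded operators, since [wot] also carries
   the unbounded functions. *)
Definition wot_closed (dot : {dot H for Num.conj}) (M : set (H -> H)) :=
  forall T, bounded_operator T -> closure (M : set (wot dot)) T -> M T.

Record von_neumann_algebra (dot : {dot H for Num.conj}) (M : set (H -> H)) :
  Prop := VonNeumannAlgebra {
  vna_bounded : forall T, M T -> bounded_operator T;
  vna_id : M idfun;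
  vna_add : forall S T, M S -> M T -> M (S + T);
  vna_scale : forall (a : R[i]) T, M T -> M (a *: T);
  vna_comp : forall S T, M S -> M T -> M (S \o T);
  vna_adjoint : forall T, M T -> exists2 T', M T' & adjoint_of dot T T';
  vna_closed : wot_closed dot M }.

Definition prime_algebra (M : set (H -> H)) :=
  forall a b, M a -> M b -> (forall m, M m -> a \o m \o b = 0) ->
    a = 0 \/ b = 0.

Definition positive_operator (dot : {dot H for Num.conj}) (A : H -> H) :=
  forall h, 0 <= dot (A h) h.

Definition invertible_in (M : set (H -> H)) (T : H -> H) :=
  exists2 S, M S & T \o S = idfun /\ S \o T = idfun.

Definition spectrum (M : set (H -> H)) (T : H -> H) : set R[i]^o :=
  [set l | ~ invertible_in M (l *: idfun - T)].

Definition well_supported (M : set (H -> H)) (A : H -> H) :=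
  closed (spectrum M A `\ 0).

Section ASeminorm.
Variables (dot : {dot H for Num.conj}) (M : set (H -> H)) (A : H -> H).

(* [A] is positive wherever this is used, so [<A h, h>] equals its real part. *)
Definition vec_seminorm (h : H) : R := Num.sqrt (complex.Re (dot (A h) h)).

Definition op_seminorm (T : H -> H) : \bar R :=
  ereal_sup [set (vec_seminorm (T h))%:E | h in [set h | vec_seminorm h = 1]].

Definition Abounded : set (H -> H) :=
  [set T | M T /\ (op_seminorm T < +oo)%E].

Definition Ainvertible (T : H -> H) :=
  exists2 S, Abounded S & A \o T \o S = A /\ A \o S \o T = A.

Definition Aspectrum (T : H -> H) : set R[i] :=
  [set l | ~ Ainvertible (l *: idfun - T)].

Definition Aspectral_radius (T : H -> H) : \bar R :=
  ereal_sup [set (complex.Re `|l|)%:E | l in Aspectrum T].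

End ASeminorm.

End Operators.

(* Main.v *)
Require Import Defs.
From HB Require Import structures.
From mathcomp Require Import all_boot all_order all_algebra.
From mathcomp Require Import all_classical all_reals all_analysis.
From mathcomp Require Import complex.
From mathcomp Require Import ring lra cyclic separable cyclotomic.

Set Implicit Arguments.
Unset Strict Implicit.
Unset Printing Implicit Defensive.
Import Order.TTheory GRing.Theory Num.Theory.
Import numFieldNormedType.Exports.
Local Open Scope classical_set_scope.
Local Open Scope ring_scope.

(** Let [p] be the support projection of [A]. An operator of the algebra is
    bounded for the seminorm of [A] exactly when it maps the kernel of [A] into
    itself, that is when [p T = p T p], and up to the value [0] its
    [A]-spectrum is the spectrum of the compression [p T p]. So the statement
    is about the elements [s = p S p] and [t = p T p] and ordinary spectra, plus
    the fact that the [A]-spectrum is never empty.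

    If [A S = alpha A T] then the spectrum of [s x] is [alpha] times that of
    [t x], and the inequality of radii is immediate, except for [alpha = 0]:
    then the left radius is [0], and the right one is nonnegative because the
    [A]-spectrum is nonempty ([Aspectrum_nonempty], a form of Gelfand's theorem
    proved by averaging resolvents over roots of unity as Rickart did).

    For the converse, test the radii on [X = p y w z p] with [w = (z s y)^*].
    Since [x y] and [y x] have the same nonzero spectral values, this compares
    [|z s y| ^ 2], a spectral value of [z s y w], with [|z t y w|], and gives
    [|z s y| <= |z t y|] for all [z] and [y] ([radius_domination]).
    Choosing [z = exp (l t x)] and [y = exp (- l x t)] makes [z t y = t], so
    [l |-> z s y] is a bounded entire function; it is constant, and its
    derivative [t x s - s x t] at [0] vanishes ([dominated_commute], where the
    exponentials are replaced by [n]-th powers and Liouville's theorem by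
    Cauchy's estimate for polynomials).

    It remains to deduce [s = alpha t] from [t x s = s x t] for all [x]. For
    [a = t^* t] the real and imaginary parts [b] of [t^* s] satisfy
    [b x a = a x b]. Every difference [d = b - m a] with [m] real has the same
    property, and splitting [d] into its positive and negative part, primeness
    forces [d >= 0] or [d <= 0] ([self_definite]). As [m] increases through
    [<b h, h> / <a h, h>], the sign has to change, which leaves [b = m a].
    The bound [|alpha| <= 1] is [|s| <= |t|]. *)

(** * Complex numbers: modulus and roots of unity *)

Local Notation normc := ComplexField.Normc.normc.

Section NormC.
Context {R : realType}.
Implicit Types z : R[i].

Lemma normr_normc z : `|z| = (normc z)%:C%C.
Proof. by []. Qed.

Lemma normc_ge0 z : 0 <= normc z.
Proof. by rewrite -lecR -normr_normc normr_ge0. Qed.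

Lemma normcX z n : normc (z ^+ n) = normc z ^+ n.
Proof. by apply: complexI; rewrite rmorphXn /= -!normr_normc normrX. Qed.

Lemma normcR (r : R) : 0 <= r -> normc r%:C%C = r.
Proof. by move=> r0; apply: complexI; rewrite -normr_normc ger0_norm ?ler0c. Qed.

Lemma prim_root_exists n : (n > 0)%N -> exists z : R[i], n.-primitive_root z.
Proof.
move=> n_gt0; pose p : {poly R[i]} := 'X^n - 1.
have [r Dp] := closed_field_poly_normal p.
rewrite (monicP _) ?monicXnsubC // scale1r in Dp.
have rn1: all n.-unity_root r by apply/allP=> z; rewrite -root_prod_XsubC -Dp.
have sz_r: (n < (size r).+1)%N.
  by rewrite -(size_prod_XsubC r id) -Dp size_XnsubC.
have [|z] := hasP (has_prim_root n_gt0 rn1 _ sz_r); last by exists z.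
by rewrite -separable_prod_XsubC -Dp separable_Xn_sub_1 // pnatr_eq0 -lt0n.
Qed.

Lemma normc_prim_root n z : (n > 0)%N -> n.-primitive_root z -> normc z = 1.
Proof.
move=> n0 /prim_expr_order/(congr1 (@normc R)).
rewrite normcX ComplexField.Normc.normc1 => /eqP; rewrite pexpr_eq1 ?normc_ge0 //.
by move=> /eqP.
Qed.

Lemma sum_prim_root n z k : n.-primitive_root z ->
  \sum_(j < n) (z ^+ k) ^+ j = if (n %| k)%N then n%:R else 0.
Proof.
move=> zP; case: ifPn => [nk|nk].
  rewrite (eq_bigr (fun=> 1)) ?sumr_const ?card_ord // => j _.
  by move: nk; rewrite (prim_order_dvd zP) => /eqP ->; rewrite expr1n.
have zk : z ^+ k - 1 != 0 by rewrite subr_eq0 -(prim_order_dvd zP).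
apply: (mulfI zk); rewrite mulr0 -subrX1 exprAC (prim_expr_order zP).
by rewrite expr1n subrr.
Qed.

End NormC.

(** * Banach algebras *)

Section BanachAlgebra.
Context {R : realType} {B : algType R[i]}.
Implicit Types (x y z : B) (N : B -> R) (l : R[i]).

(** Completeness is phrased through a modulus [e] of convergence, so that
    identities pass to the limit by explicit estimates. *)
Record banach_norm N : Prop := BanachNorm {
  bnormD : forall x y, N (x + y) <= N x + N y;
  bnormZ : forall l x, N (l *: x) = normc l * N x;
  bnormM : forall x y, N (x * y) <= N x * N y;
  bnorm1 : N 1 = 1;
  bnorm_eq0 : forall x, N x = 0 -> x = 0;
  bnorm_complete : forall (u : nat -> B) (e : nat -> R),
    (forall n k, N (u (n + k)%N - u n) <= e n) ->
    (forall d, 0 < d -> exists n, e n <= d) ->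
    exists x, forall n, N (u n - x) <= e n }.

Definition has_inverse x := exists2 y, x * y = 1 & y * x = 1.

Lemma has_inverseM x y : has_inverse x -> has_inverse y -> has_inverse (x * y).
Proof.
move=> [x' xx' x'x] [y' yy' y'y]; exists (y' * x').
  by rewrite mulrA -(mulrA x) yy' mulr1.
by rewrite mulrA -(mulrA y') x'x mulr1.
Qed.

Lemma has_inverseZ l x : l != 0 -> has_inverse x -> has_inverse (l *: x).
Proof.
move=> l0 [y xy yx]; exists (l^-1 *: y).
  by rewrite -scalerAl -scalerAr xy !scalerA mulfV ?scale1r.
by rewrite -scalerAl -scalerAr yx !scalerA mulVf ?scale1r.
Qed.

(** Jacobson's identity: an inverse [c] of [l - x * y] yields the inverse
    [l^-1 (1 + y * c * x)] of [l - y * x]. *)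
Lemma has_inverse_swap l x y : l != 0 ->
  has_inverse (l *: 1 - x * y) -> has_inverse (l *: 1 - y * x).
Proof.
move=> l0 [c h1 h2].
have e1 : x * y * c = l *: c - 1.
  by move: h1; rewrite mulrBl -scalerAl mul1r => <-; rewrite subKr.
have e2 : c * (x * y) = l *: c - 1.
  by move: h2; rewrite mulrBr -scalerAr mulr1 => <-; rewrite subKr.
exists (l^-1 *: (1 + y * c * x)).
  rewrite -scalerAr mulrBl -scalerAl mul1r mulrDr mulr1.
  have -> : y * x * (y * c * x) = y * (x * y * c) * x by rewrite !mulrA.
  rewrite e1 mulrBr mulr1 mulrBl -scalerAr -scalerAl.
  by rewrite [y * x + _]addrC subrK -scalerBr addrK scalerA mulVf ?scale1r.
rewrite -scalerAl mulrBr -scalerAr mulr1 mulrDl mul1r.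
have -> : y * c * x * (y * x) = y * (c * (x * y)) * x by rewrite !mulrA.
rewrite e2 mulrBr mulr1 mulrBl -scalerAr -scalerAl.
by rewrite [y * x + _]addrC subrK -scalerBr addrK scalerA mulVf ?scale1r.
Qed.

Section Norm.
Variables (N : B -> R) (hN : banach_norm N).

Lemma bnorm0 : N 0 = 0.
Proof. by rewrite -(scale0r (0 : B)) (bnormZ hN) ComplexField.Normc.normc0 mul0r. Qed.

Lemma bnormN x : N (- x) = N x.
Proof. by rewrite -scaleN1r (bnormZ hN) normcN ComplexField.Normc.normc1 mul1r. Qed.

Lemma bnormB x y : N (x - y) <= N x + N y.
Proof. by rewrite -(bnormN y) (bnormD hN). Qed.

Lemma bnorm_sym x y : N (x - y) = N (y - x).
Proof. by rewrite -bnormN opprB. Qed.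

Lemma bnorm_ge0 x : 0 <= N x.
Proof. by have := bnormB x x; rewrite subrr bnorm0; lra. Qed.

Lemma bnorm_tri x y z : N (x - z) <= N (x - y) + N (y - z).
Proof. by have := bnormD hN (x - y) (y - z); rewrite addrA subrK. Qed.

Lemma bnormX x n : N (x ^+ n) <= N x ^+ n.
Proof.
elim: n => [|n IH]; first by rewrite !expr0 (bnorm1 hN).
by rewrite !exprS (le_trans (bnormM hN _ _)) // ler_wpM2l // bnorm_ge0.
Qed.

Lemma bnorm_sum (I : finType) (F : I -> B) :
  N (\sum_i F i) <= \sum_i N (F i).
Proof.
elim/big_ind2: _ => //; first by rewrite bnorm0.
by move=> x a y b xa yb; rewrite (le_trans (bnormD hN _ _)) // lerD.
Qed.

(** Passing to the limit in an identity amounts to bounding the difference of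
    its two sides by a multiple of the modulus [e]. *)
Lemma small_eq0 (e : nat -> R) (C : R) x : 0 <= C ->
  (forall n, N x <= C * e n) -> (forall d, 0 < d -> exists n, e n <= d) ->
  x = 0.
Proof.
move=> C0 xe e0; apply: (bnorm_eq0 hN); apply/eqP; rewrite -[_ == 0]negbK.
apply/negP => Nx0; have x0 : 0 < N x by rewrite lt_def Nx0 bnorm_ge0.
have C1 : 0 < C + 1 by lra.
have [n en] := e0 _ (divr_gt0 x0 C1).
have := le_trans (xe n) (ler_wpM2l C0 en).
by rewrite mulrCA ler_pMr // ler_pdivlMr //; lra.
Qed.

Lemma geometric_small (C q d : R) : 0 <= q < 1 -> 0 < d ->
  exists n, C * q ^+ n <= d.
Proof.
move=> /andP[q0 q1] d0.
have : (fun n => C * q ^+ n) @ \oo --> C * 0.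
  by apply: cvgMr; apply: cvg_expr; rewrite ger0_norm.
rewrite mulr0 => /cvgrPdist_le /(_ d d0)[n _ /(_ n (leqnn n))] /=.
rewrite sub0r normrN => h; exists n; exact: le_trans (ler_norm _) h.
Qed.

(** The geometric series [\sum_k x ^+ k] is the inverse. *)
Lemma neumann1 x : N x < 1 -> has_inverse (1 - x).
Proof.
move=> x1; have x0 := bnorm_ge0 x; set q := N x in x1 x0.
have q1 : 0 < 1 - q by lra.
pose u n := \sum_(k < n) x ^+ k; pose e n := (1 - q)^-1 * q ^+ n.
have uX n k : u (n + k)%N - u n = x ^+ n * u k.
  rewrite /u big_split_ord /= addrAC subrr add0r mulr_sumr.
  by apply: eq_bigr => i _; rewrite exprD.
have ub k : N (u k) <= (1 - q)^-1.
  apply: le_trans (bnorm_sum _) _; rewrite -[leRHS]mul1r ler_pdivlMr //.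
  apply: le_trans (_ : (\sum_(i < k) q ^+ i) * (1 - q) <= _).
    by rewrite ler_wpM2r ?ler_sum ?(ltW q1) // => i _; apply: bnormX.
  by rewrite mulrC -opprB mulNr -subrX1 opprB gerBl exprn_ge0.
have ue n k : N (u (n + k)%N - u n) <= e n.
  rewrite uX /e mulrC (le_trans (bnormM hN _ _)) // ler_pM ?bnorm_ge0 //.
  exact: bnormX.
have e0 d : 0 < d -> exists n, e n <= d.
  by apply: geometric_small; rewrite x0 x1.
have [y uy] := bnorm_complete hN ue e0.
have xu n : (1 - x) * u n = 1 - x ^+ n by rewrite -opprB mulNr -subrX1 opprB.
have ux n : u n * (1 - x) = 1 - x ^+ n.
  rewrite -xu /u mulr_sumr mulr_suml; apply: eq_bigr => i _.
  by rewrite mulrBr mulrBl mulr1 mul1r -exprS -exprSr.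
have C0 : 0 <= N (1 - x) + (1 - q) by rewrite addr_ge0 ?bnorm_ge0 ?ltW.
have qe n : N (x ^+ n) <= (1 - q) * e n.
  by rewrite mulrA mulfV ?gt_eqF // mul1r bnormX.
exists y; apply/eqP; rewrite -subr_eq0; apply/eqP/(small_eq0 C0 _ e0) => n.
  have -> : (1 - x) * y - 1 = (1 - x) * (y - u n) - x ^+ n.
    by rewrite mulrBr xu -addrA -opprD subrK.
  rewrite [leRHS]mulrDl (le_trans (bnormB _ _)) // lerD //.
  by rewrite (le_trans (bnormM hN _ _)) // ler_wpM2l ?bnorm_ge0 // bnorm_sym.
have -> : y * (1 - x) - 1 = (y - u n) * (1 - x) - x ^+ n.
  by rewrite mulrBl ux -addrA -opprD subrK.
rewrite [leRHS]mulrDl (le_trans (bnormB _ _)) // lerD //.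
rewrite (le_trans (bnormM hN _ _)) // mulrC ler_wpM2l ?bnorm_ge0 //.
by rewrite bnorm_sym.
Qed.

Lemma neumann l x : N x < normc l -> has_inverse (l *: 1 - x).
Proof.
move=> xl; have l0 : l != 0.
  apply: contraTneq xl => ->; rewrite ComplexField.Normc.normc0 -leNgt.
  exact: bnorm_ge0.
have -> : l *: 1 - x = l *: (1 - l^-1 *: x).
  by rewrite scalerBr scalerA mulfV ?scale1r.
apply: has_inverseZ => //; apply: neumann1; rewrite (bnormZ hN).
rewrite ComplexField.Normc.normcV mulrC ltr_pdivrMr ?mul1r //.
exact: le_lt_trans (bnorm_ge0 x) xl.
Qed.

End Norm.
End BanachAlgebra.

(** * Domination implies commutation *)

Section Liouville.
Context {R : realType} {B : algType R[i]}.
Variables (N : B -> R) (hN : banach_norm N).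
Implicit Types (x y z s t : B) (l : R[i]).

Lemma scale1_expr l n : (l%:A : B) ^+ n = (l ^+ n)%:A.
Proof. by rewrite exprZn expr1n. Qed.

Lemma coef1M (p q : {poly B}) : (p * q)`_1 = p`_0 * q`_1 + p`_1 * q`_0.
Proof. by rewrite coefM 2!big_ord_recl big_ord0 addr0. Qed.

Lemma coef_exp_1addX x n :
  ((1 + x%:P * 'X) ^+ n)`_0 = 1 /\ ((1 + x%:P * 'X) ^+ n)`_1 = x *+ n.
Proof.
have p0 : (1 + x%:P * 'X)`_0 = 1 by rewrite coefD coef1 coefMX addr0.
have p1 : (1 + x%:P * 'X)`_1 = x by rewrite coefD coef1 coefMX coefC /= add0r.
elim: n => [|n [IH0 IH1]]; first by rewrite expr0 !coef1 mulr0n.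
by rewrite exprS coef0M coef1M p0 p1 IH0 IH1 !mulr1 mul1r mulrSr.
Qed.

(** Averaging [w ^- j * p(r w ^ j)] over the powers of a root of unity [w] of
    order larger than [size p] leaves only the linear coefficient. *)
Lemma cauchy_estimate (p : {poly B}) (r C : R) : 0 < r ->
  (forall l, normc l = r -> N p.[l%:A] <= C) -> r * N p`_1 <= C.
Proof.
move=> r0 pC; pose m := size p; pose n := m.+2.
have [w wP] := @prim_root_exists R n isT.
pose a j : R[i] := r%:C%C * w ^+ j.
have w1 : normc w = 1 by apply: normc_prim_root wP.
have aE j : normc (a j) = r.
  rewrite ComplexField.Normc.normcM normcR ?(ltW r0) // normcX w1.
  by rewrite expr1n mulr1.
have nn i : (i < n)%N -> (n %| n.-1 + i)%N = (i == 1%N).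
  case: i => [|[|i]] ilt //; first by rewrite addn0 gtnNdvd.
    by rewrite addn1 dvdnn.
  have -> : (n.-1 + i.+2 = n + i.+1)%N by rewrite /n /= !addnS addSn.
  by rewrite dvdn_addr ?dvdnn // gtnNdvd // ltnW.
have S : \sum_(j < n) (w ^+ n.-1) ^+ j *: p.[(a j)%:A]
    = (n%:R * r%:C%C) *: p`_1.
  transitivity (\sum_(i < n) (r%:C%C ^+ i *
      \sum_(j < n) (w ^+ (n.-1 + i)) ^+ j) *: p`_i).
    rewrite (eq_bigr (fun j : 'I_n => \sum_(i < n)
        (r%:C%C ^+ i * (w ^+ (n.-1 + i)) ^+ j) *: p`_i)); last first.
      move=> j _; rewrite (@horner_coef_wide _ n); last by rewrite /n ltnW.
      rewrite scaler_sumr; apply: eq_bigr => i _.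
      rewrite scale1_expr mulr_algr scalerA; congr (_ *: _).
      by rewrite /a exprMn mulrCA exprD exprMn -!exprM [(i * j)%N]mulnC.
    by rewrite exchange_big; apply: eq_bigr => i _; rewrite mulr_sumr scaler_suml.
  have n1 : (1 < n)%N by [].
  rewrite (bigD1 (Ordinal n1)) //= [X in _ + X]big1 ?addr0; last first.
    move=> i i1; rewrite (sum_prim_root _ wP) nn //.
    suff /negPf -> : (i : nat) != 1%N by rewrite mulr0 scale0r.
    by apply: contraNneq i1 => i1; apply/eqP/val_inj.
  by rewrite (sum_prim_root _ wP) nn //= expr1 mulrC.
have nC : (n%:R : R[i]) = (n%:R : R)%:C%C by rewrite rmorph_nat.
have n0 : (0 : R) < n%:R by rewrite ltr0n.
have : N ((n%:R * r%:C%C) *: p`_1) <= n%:R * C.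
  rewrite -S; apply: le_trans (bnorm_sum hN _) _.
  have -> : n%:R * C = \sum_(j < n) C by rewrite sumr_const card_ord mulr_natl.
  apply: ler_sum => j _; rewrite (bnormZ hN) !normcX w1 !expr1n mul1r.
  exact: pC (aE j).
rewrite (bnormZ hN) nC -rmorphM normcR; last by rewrite mulr_ge0 ?ltW.
by rewrite -mulrA ler_pM2l.
Qed.

(** The induction is Bernoulli's inequality [(1 + v) ^ k (1 - k v) <= 1]. *)
Lemma exp_1add_le2 (v : R) n : 0 <= v -> n%:R * v <= 2^-1 -> (1 + v) ^+ n <= 2.
Proof.
move=> v0 nv.
have key k : (1 + v) ^+ k * (1 - k%:R * v) <= 1.
  elim: k => [|k IH]; first by rewrite expr0 mul0r subr0 mulr1.
  apply: le_trans IH; rewrite exprSr -mulrA ler_wpM2l ?exprn_ge0 ?addr_ge0 //.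
  have k0 : 0 <= k%:R * v * v by rewrite !mulr_ge0.
  have v2 : 0 <= v * v by rewrite mulr_ge0.
  rewrite -natr1; nra.
have p0 : 0 <= (1 + v) ^+ n by rewrite exprn_ge0 ?addr_ge0.
have := key n; nra.
Qed.

(** With [u = l x t / n], the factors [z = (1 + l t x / n) ^ n] and
    [y = (1 - l x t / n) ^ n] satisfy [z t y = t (1 - u ^ 2) ^ n], which stays
    bounded as [l] ranges over a large circle and [n] grows.  So does [z s y],
    a polynomial in [l] with linear coefficient [t x s - s x t]; this is
    Liouville's theorem for [exp (l t x) s exp (- l x t)]. *)
Lemma dominated_commute s t :
  (forall z y, N (z * s * y) <= N (z * t * y)) ->
  forall x, t * x * s = s * x * t.
Proof.
move=> st x; apply/eqP; rewrite -subr_eq0; apply/eqP.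
have C0 : 0 <= 2 * N t by rewrite mulr_ge0 ?bnorm_ge0.
apply: (small_eq0 hN C0 (e := fun n => n.+1%:R^-1)); last first.
  move=> d d0; exists (Num.truncn d^-1).
  rewrite invf_ple ?posrE ?ltr0n // ltW //; exact: truncnS_gt.
move=> k; have r0 : (0 : R) < k.+1%:R by rewrite ltr0n.
set r : R := k.+1%:R in r0 *; rewrite ler_pdivlMr // mulrC.
set K := N (x * t); have K0 : 0 <= K by apply: bnorm_ge0.
pose n := (Num.truncn (2 * (r * K) ^+ 2)).+1.
have n0 : (0 : R) < n%:R by rewrite ltr0n.
have nn : 2 * (r * K) ^+ 2 <= n%:R by rewrite ltW // truncnS_gt.
pose c : R[i] := (n%:R^-1 : R)%:C%C.
have cn : c *+ n = 1.
  rewrite /c -rmorphMn /= -mulr_natr mulVf ?gt_eqF //.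
pose U := c *: (t * x); pose V := c *: (x * t).
have UV : U * t = t * V by rewrite -scalerAl -scalerAr mulrA.
pose p := (1 + U%:P * 'X) ^+ n * s%:P * (1 + (- V)%:P * 'X) ^+ n.
have p1 : p`_1 = t * x * s - s * x * t.
  have [a0 a1] := coef_exp_1addX U n; have [b0 b1] := coef_exp_1addX (- V) n.
  rewrite /p coef1M coef1M coef0M a0 a1 b0 b1 !coefC /= mulr0 add0r mulr1 mul1r.
  rewrite addrC mulNrn mulrN /U /V !scalerMnl cn !scale1r.
  by rewrite mulrA.
rewrite -p1; apply: cauchy_estimate => // l lr.
have ev y m : ((1 + y%:P * 'X) ^+ m).[l%:A] = (1 + l *: y) ^+ m.
  elim: m => [|m IH]; first by rewrite !expr0 hornerC.
  rewrite !exprS hornerM_comm; last first.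
    by rewrite /comm_poly mulr_algl mulr_algr.
  by rewrite IH hornerD hornerC hornerMX hornerC mulr_algr.
have -> : p.[l%:A] = (1 + l *: U) ^+ n * s * (1 - l *: V) ^+ n.
  have cp q : comm_poly q (l%:A : B) by rewrite /comm_poly mulr_algl mulr_algr.
  by rewrite /p !hornerM_comm // !ev // hornerC scalerN.
apply: le_trans (st _ _) _.
have zt m : (1 + l *: U) ^+ m * t = t * (1 + l *: V) ^+ m.
  elim: m => [|m IH]; first by rewrite !expr0 mul1r mulr1.
  rewrite exprS -mulrA IH mulrA [in RHS]exprS mulrA; congr (_ * _).
  by rewrite mulrDl mulrDr mul1r mulr1 -scalerAl UV scalerAr.
rewrite zt -mulrA.
have -> : (1 + l *: V) ^+ n * (1 - l *: V) ^+ n = (1 - (l *: V) ^+ 2) ^+ n.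
  rewrite -exprMn_comm; last first.
    apply: commrB; first exact: commr1.
    by rewrite /GRing.comm mulrDl mulrDr mul1r mulr1.
  congr (_ ^+ n); rewrite mulrDl mul1r mulrBr mulr1 expr2.
  by rewrite addrA subrK.
apply: le_trans (bnormM hN _ _) _; rewrite [leRHS]mulrC ler_wpM2l ?bnorm_ge0 //.
apply: le_trans (bnormX hN _ _) _.
have lV : N (l *: V) = r * K / n%:R.
  rewrite (bnormZ hN) lr (bnormZ hN) normcR ?invr_ge0 ?ltW //.
  by rewrite mulrCA mulrC.
apply: le_trans (_ : (1 + (r * K / n%:R) ^+ 2) ^+ n <= 2).
  apply: lerXn2r; rewrite ?nnegrE ?bnorm_ge0 ?addr_ge0 ?sqr_ge0 //.
  rewrite (le_trans (bnormB hN _ _)) // (bnorm1 hN) lerD2l -lV.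
  exact: bnormX.
apply: exp_1add_le2; first exact: sqr_ge0.
rewrite expr_div_n expr2 -expr2 [n%:R ^+ 2]expr2 invfM mulrCA !mulrA mulfK ?gt_eqF //.
by rewrite ler_pdivrMr //; lra.
Qed.

End Liouville.

(** * Nonempty spectrum *)

Section Gelfand.
Context {R : realType}.

Lemma normc_le (a b : R) : normc (a +i* b)%C <= `|a| + `|b|.
Proof.
have -> : (a +i* b)%C = (a +i* 0)%C + (0 +i* b)%C :> R[i].
  by apply/eqP; rewrite eq_complex /= addr0 add0r !eqxx.
apply: le_trans (le_normcD _ _) _.
by rewrite /= !expr0n /= addr0 add0r !sqrtr_sqr.
Qed.

Lemma ReIm_le_normc (l : R[i]) : `|complex.Re l| <= normc l /\ `|complex.Im l| <= normc l.
Proof.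
case: l => a b /=; rewrite -(sqrtr_sqr a) -(sqrtr_sqr b).
by split; apply: ler_wsqrtr; rewrite ?lerDl ?lerDr sqr_ge0.
Qed.

(** Compactness of a square containing the disc. *)
Lemma locally_bounded_disc (f : R[i] -> R) (r : R) :
  (forall m, exists C, exists2 d, 0 < d &
    forall l, normc (l - m) <= d -> f l <= C) ->
  exists K, forall l, normc l <= r -> f l <= K.
Proof.
move=> floc; pose Q : set (R * R) := `[- r, r] `*` `[- r, r].
have : compact Q by apply: compact_setX; apply: segment_compact.
move=> /compact_near_coveringP.
move=> /(_ R +oo (fun i p => f (p.1 +i* p.2)%C <= i) _).
case.
  move=> [a b] _; have [C [d d0 fC]] := floc (a +i* b)%C.
  exists (ball (a, b) (d / 2), [set i | C <= i]) => /=.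
    split; last exact: nbhs_pinfty_ge (num_real _).
    exact: (nbhsx_ballx (a, b) _ (divr_gt0 d0 _)).
  move=> [[a' b'] i] /= [[]]; rewrite /ball /= => aa bb Ci.
  apply: le_trans Ci; apply: fC => /=.
  apply: le_trans (normc_le _ _) _; rewrite distrC in aa; rewrite distrC in bb.
  by move: aa bb; lra.
move=> K [_ QK]; exists (K + 1) => l lr.
have [l1 l2] := ReIm_le_normc l.
have K1 : K < K + 1 by rewrite ltrDl.
have := QK (K + 1) K1 (complex.Re l, complex.Im l).
rewrite /=; case: l lr l1 l2 => a b /= lr l1 l2; apply.
by split; rewrite /= in_itv /= -ler_norml (le_trans _ lr).
Qed.

Context {B : algType R[i]}.
Variables (N : B -> R) (hN : banach_norm N).
Implicit Types (c p v : B).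

(** Rickart's proof of Gelfand's theorem, for the corner of an idempotent [p]
    in which [c] has the inverse [v]. If no nonzero [l] belonged to the
    spectrum, [G m = (1 - m c)^-1] would be defined for all [m]. Its average
    [A n r] over the [m] with [m ^ (n + 1) = r ^ (n + 1)] is [(1 - u)^-1] for
    [u = (r c) ^ (n + 1)]. A small [u] means [A n r] close to [1]; since the
    functions [A n] are equicontinuous, this propagates from [r = 0] to every
    [r], whereas [G m * p] is small when [m] is large. *)
Lemma corner_spectrum_nonempty c p v : p != 0 -> p * p = p ->
  c * v = p -> p * v = v -> exists2 l, l != 0 & ~ has_inverse (l *: 1 - c).
Proof.
move=> p0 pp cv pv; apply: contrapT => /forall2NP noinv.
have hG m : exists y, (1 - m *: c) * y = 1 /\ y * (1 - m *: c) = 1.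
  case: (eqVneq m 0) => [->|m0].
    by exists 1; rewrite scale0r subr0 mulr1.
  suff [y h1 h2] : has_inverse (1 - m *: c) by exists y.
  have -> : 1 - m *: c = m *: (m^-1 *: 1 - c).
    by rewrite scalerBr scalerA mulfV ?scale1r.
  apply: has_inverseZ => //; case: (noinv m^-1) => [|/contrapT //].
  by rewrite invr_eq0 => /negP; rewrite m0.
have [G GP] := choice hG; clear hG noinv.
have G0 : G 0 = 1 by have [] := GP 0; rewrite scale0r subr0 mul1r.
(* The resolvent identity. *)
have res m m' : G m - G m' = (m - m') *: (G m * c * G m').
  have -> : G m - G m' = G m * ((1 - m' *: c) - (1 - m *: c)) * G m'.
    by rewrite mulrBr mulrBl -mulrA (GP m').1 (GP m).2 mulr1 mul1r.
  rewrite opprB addrC addrA subrK -scalerBl.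
  by rewrite -scalerAr -scalerAl.
have Nc0 := bnorm_ge0 hN c.
have Gloc m : exists C, exists2 d, 0 < d &
    forall l, normc (l - m) <= d -> N (G l) <= C.
  have b0 : 0 <= N (G m) * N c by rewrite mulr_ge0 ?bnorm_ge0.
  have d1 : 0 < 2 * (N (G m) * N c + 1) by lra.
  exists (2 * N (G m)); exists (2 * (N (G m) * N c + 1))^-1; first by rewrite invr_gt0.
  move=> l; rewrite -[X in _ <= X]mul1r ler_pdivlMr // => lm.
  have h : N (G l) <= N (G m) + normc (l - m) * (N (G l) * N c * N (G m)).
    rewrite -[G l](subrK (G m)) {1}res addrC.
    apply: le_trans (bnormD hN _ _) _; rewrite lerD2l (bnormZ hN) subrK.
    rewrite ler_wpM2l ?normc_ge0 //; apply: le_trans (bnormM hN _ _) _.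
    by rewrite ler_wpM2r ?bnorm_ge0 ?(bnormM hN).
  have g0 := bnorm_ge0 hN (G l); have n0 := normc_ge0 (l - m).
  have : normc (l - m) * (N (G m) * N c) <= 2^-1.
    have : 0 <= normc (l - m) by []. by lra.
  nra.
have v0 := bnorm_ge0 hN v.
(* For [|m| = r1] the formula [m G m p = G m p v - v] bounds [G m p]. *)
pose r1 := 4 * N v + 1; have r10 : 0 < r1 by rewrite /r1; lra.
have Gp m : normc m = r1 -> N (G m * p) <= 3^-1.
  move=> mr; have m0 : m != 0.
    by apply: contraTneq r10 => m0; rewrite -mr m0 ComplexField.Normc.normc0 ltxx.
  have e : m *: (G m * p) = G m * p * v - v.
    rewrite -mulrA pv -{2}[v]mul1r -(GP m).2 -mulrA mulrBl mul1r -scalerAl cv.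
    by rewrite mulrBr opprB addrC subrK scalerAr.
  have : r1 * N (G m * p) <= N (G m * p) * N v + N v.
    rewrite -mr -(bnormZ hN) e; apply: le_trans (bnormB hN _ _) _.
    by rewrite lerD2r (bnormM hN).
  have := bnorm_ge0 hN (G m * p); rewrite /r1; nra.
have [K GK] := locally_bounded_disc (r1 + 1) Gloc.
have K1 : 1 <= K.
  by rewrite -(bnorm1 hN) -G0 GK // ComplexField.Normc.normc0; lra.
have [w wP] := choice (fun n => @prim_root_exists R n.+1 isT).
pose a n (r : R) j : R[i] := r%:C%C * w n ^+ j.
have aE n r j : 0 <= r -> normc (a n r j) = r.
  move=> r0; rewrite ComplexField.Normc.normcM normcR // normcX.
  by rewrite (normc_prim_root _ (wP n)) // expr1n mulr1.
pose S n r := \sum_(j < n.+1) G (a n r j).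
pose A n r := (n.+1%:R : R[i])^-1 *: S n r.
have normn n : normc (n.+1%:R : R[i])^-1 = n.+1%:R^-1.
  by rewrite -(rmorph_nat (real_complex R)) -fmorphV normcR ?invr_ge0.
have avg (F : nat -> B) n C : (forall j, N (F j) <= C) ->
    N ((n.+1%:R : R[i])^-1 *: \sum_(j < n.+1) F j) <= C.
  move=> FC; rewrite (bnormZ hN) normn ler_pdivrMl ?ltr0n //.
  apply: le_trans (bnorm_sum hN _) _.
  have -> : n.+1%:R * C = \sum_(j < n.+1) C by rewrite sumr_const card_ord mulr_natl.
  by apply: ler_sum.
pose u n (r : R) := (r%:C%C *: c) ^+ n.+1.
(* [(1 - u) G(a_j)] is the geometric sum [\sum_k (a_j c) ^ k], and averaging
   over [j] keeps only the term [k = 0]. *)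
have SE n r : (1 - u n r) * A n r = 1 /\ A n r * (1 - u n r) = 1.
  have uE j : (a n r j *: c) ^+ n.+1 = u n r.
    rewrite /u !exprZn /a exprMn -exprM mulnC exprM (prim_expr_order (wP n)).
    by rewrite expr1n mulr1.
  have E : \sum_(j < n.+1) \sum_(k < n.+1) (a n r j *: c) ^+ k = n.+1%:R.
    rewrite exchange_big /= big_ord_recl /= [X in _ + X]big1 ?addr0.
      by rewrite (eq_bigr (fun=> 1)) ?sumr_const ?card_ord.
    move=> k _; rewrite (eq_bigr (fun j : 'I_n.+1 =>
        (r%:C%C ^+ (bump 0 k) * (w n ^+ (bump 0 k)) ^+ j) *: c ^+ (bump 0 k))).
      rewrite -scaler_suml -mulr_sumr (sum_prim_root _ (wP n)).
      rewrite gtnNdvd ?mulr0 ?scale0r //; by have := ltn_ord k.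
    by move=> j _; rewrite exprZn /a exprMn -!exprM [(j * _)%N]mulnC.
  have inv_n : (n.+1%:R : R[i])^-1 *: (n.+1%:R : B) = 1.
    have -> : (n.+1%:R : B) = (n.+1%:R : R[i]) *: 1 by rewrite scaler_nat.
    by rewrite scalerA mulVf ?scale1r // pnatr_eq0.
  split.
    rewrite /A -scalerAr /S mulr_sumr -{2}inv_n -E; congr (_ *: _).
    apply: eq_bigr => j _; rewrite -(uE j).
    rewrite -opprB subrX1 -mulNr opprB.
    rewrite -[RHS]mulr1 -[X in _ = _ * X](GP (a n r j)).1 mulrA; congr (_ * _).
    by rewrite mulr_suml mulr_sumr; apply: eq_bigr => k _;
       rewrite mulrBl mulrBr; rewrite mul1r mulr1 -exprS -exprSr.
  rewrite /A -scalerAl /S mulr_suml -{2}inv_n -E; congr (_ *: _).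
  apply: eq_bigr => j _; rewrite -(uE j).
  by rewrite -opprB subrX1 -mulNr opprB mulrA (GP _).2 mul1r.
pose Z r := forall e, 0 < e -> exists n0, forall n, (n0 <= n)%N -> N (u n r) <= e.
have AK n r : 0 <= r -> r <= r1 + 1 -> N (A n r) <= K.
  by move=> r0 rr; apply: (avg (fun j => G (a n r j))) => j; apply: GK; rewrite aE.
have A1 r : 0 <= r -> r <= r1 + 1 -> Z r ->
    exists n0, forall n, (n0 <= n)%N -> N (A n r - 1) <= 4^-1.
  move=> r0 rr /(_ (4 * K)^-1)[|n0 un]; first by rewrite invr_gt0; lra.
  exists n0 => n /un; have [_ e] := SE n r.
  have -> : A n r - 1 = A n r * u n r by rewrite -e mulrBr mulr1 subKr.
  move=> h; apply: le_trans (bnormM hN _ _) _.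
  apply: le_trans (ler_pM (bnorm_ge0 hN _) (bnorm_ge0 hN _) (AK _ _ r0 rr) h) _.
  by rewrite invfM mulrCA mulfV ?mulr1 ?gt_eqF //; lra.
have Kc : 0 <= K * N c * K by rewrite !mulr_ge0 //; lra.
(* The step [h] divides [r1], and [2 h] moves every [A n r] by at most [1/4]. *)
pose m := (Num.truncn (r1 * 8 * (K * N c * K + 1))).+1.
have m0 : (0 : R) < m%:R by rewrite ltr0n.
pose h := r1 / m%:R; have h0 : 0 < h by rewrite divr_gt0.
have hm : h * m%:R = r1 by rewrite divfK ?gt_eqF.
have h8 : h * 8 * (K * N c * K + 1) <= 1.
  rewrite /h [_ * 8]mulrAC [_ / _ * _]mulrAC ler_pdivrMr // mul1r.
  by rewrite ltW // truncnS_gt.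
(* [A n] close to [1] at [r] stays within [1/2] at [r + 2 h], so the powers
   [u n (r + 2 h)] are bounded by [1] and tend to [0] at [r + h]. *)
have step r : 0 <= r -> r <= r1 -> Z r -> Z (r + h).
  move=> r0 rr Zr.
  have h1 : h <= 8^-1 by nra.
  have [n0 An] := A1 r r0 ltac:(lra) Zr.
  have uh n : (n0 <= n)%N -> N (u n (r + 2 * h)) <= 1.
    move=> /An a1; set A2 := A n (r + 2 * h).
    have r2 : 0 <= r + 2 * h by lra.
    have a2 : N (A2 - A n r) <= 4^-1.
      rewrite /A2 /A -scalerBr /S -sumrB.
      apply: (avg (fun j => G (a n (r + 2 * h) j) - G (a n r j))) => j.
      rewrite res (bnormZ hN).
      have -> : a n (r + 2 * h) j - a n r j = a n (2 * h) j.
        by rewrite /a -mulrBl -rmorphB /= addrC addKr.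
      rewrite aE; last by lra.
      have g1 : N (G (a n (r + 2 * h) j)) <= K by apply: GK; rewrite aE //; lra.
      have g2 : N (G (a n r j)) <= K by apply: GK; rewrite aE //; lra.
      apply: le_trans (_ : 2 * h * (K * N c * K) <= _); last by nra.
      apply: ler_wpM2l; first by lra.
      apply: le_trans (bnormM hN _ _) _; apply: ler_pM; rewrite ?bnorm_ge0 //.
      by apply: le_trans (bnormM hN _ _) _; apply: ler_pM; rewrite ?bnorm_ge0.
    have a3 : N (A2 - 1) <= 2^-1.
      by apply: le_trans (bnorm_tri hN _ (A n r) _) _; lra.
    have [e _] := SE n (r + 2 * h); rewrite -/A2 in e.
    set U := u n (r + 2 * h) in e *.
    have UE : U = (A2 - 1) - U * (A2 - 1).
      by rewrite -{1}e mulrBl mul1r subKr mulrBr mulr1 subKr.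
    have : N U <= N (A2 - 1) + N U * N (A2 - 1).
      by rewrite {1}UE; apply: le_trans (bnormB hN _ _) _; rewrite lerD2l (bnormM hN).
    have := bnorm_ge0 hN U; nra.
  move=> e e0; have r2 : 0 < r + 2 * h by lra.
  have q01 : 0 <= (r + h) / (r + 2 * h) < 1.
    by rewrite divr_ge0 ?(ltW r2) ?addr_ge0 ?(ltW h0) //= ltr_pdivrMr //; lra.
  have [q0 q1] := andP q01.
  have [n1 qn] := geometric_small 1 q01 e0.
  exists (maxn n0 n1) => n; rewrite geq_max => /andP[/uh un1 n1n].
  have -> : u n (r + h) = ((r + h) / (r + 2 * h))%:C%C ^+ n.+1 *: u n (r + 2 * h).
    by rewrite /u -exprZn scalerA -rmorphM /= divfK ?gt_eqF.
  rewrite (bnormZ hN) normcX normcR //.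
  apply: le_trans (_ : ((r + h) / (r + 2 * h)) ^+ n.+1 * 1 <= _).
    by rewrite ler_wpM2l // exprn_ge0.
  rewrite mulr1; apply: le_trans qn; rewrite mul1r.
  by apply: ler_wiXn2l; rewrite ?(ltW q1) // ltnW.
have Zh k : (k <= m)%N -> Z (h * k%:R).
  elim: k => [_ e e0|k IH km].
    exists 0%N => n _; rewrite /u mulr0 scale0r expr0n /= (bnorm0 hN); exact: ltW.
  rewrite -addn1 natrD mulrDr mulr1; apply: step (IH (ltnW km)).
    by rewrite mulr_ge0 // ltW.
  by rewrite -hm ler_wpM2l ?(ltW h0) // ler_nat ltnW.
have Zr1 : Z r1 by rewrite -hm; apply: Zh.
have [n0 /(_ n0 (leqnn _)) An] := A1 r1 (ltW r10) ltac:(lra) Zr1.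
have Ap : N (A n0 r1 * p) <= 3^-1.
  rewrite /A -scalerAl /S mulr_suml.
  by apply: (avg (fun j => G (a n0 r1 j) * p)) => j; apply: Gp; rewrite aE // ltW.
have Np0 : 0 < N p.
  rewrite lt_def bnorm_ge0 // andbT; apply: contra_neq p0; exact: bnorm_eq0.
have Np1 : 1 <= N p by have := bnormM hN p p; rewrite pp; nra.
have : N p <= N (A n0 r1 * p) + N ((A n0 r1 - 1) * p).
  have {1}-> : p = A n0 r1 * p - (A n0 r1 - 1) * p.
    by rewrite mulrBl mul1r subKr.
  exact: bnormB.
have := bnormM hN (A n0 r1 - 1) p; nra.
Qed.

End Gelfand.

(** * Hilbert space *)

Section Hilbert.
Context {R : realType} {H : completeNormedModType R[i]}.
Variables (dot : {dot H for Num.conj}).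
Hypothesis hdot : induces_norm dot.
Implicit Types (x y h : H) (l : R[i]).

Definition nrm h : R := complex.Re `|h|.
Definition rdot x y : R := complex.Re (dot x y).

Lemma nrmE h : `|h| = (nrm h)%:C%C.
Proof. by rewrite /nrm RRe_real // normr_real. Qed.

Lemma nrm_ge0 h : 0 <= nrm h.
Proof. by rewrite -lecR -nrmE normr_ge0. Qed.

Lemma nrmD x y : nrm (x + y) <= nrm x + nrm y.
Proof. by rewrite -lecR rmorphD /= -!nrmE ler_normD. Qed.

Lemma nrmZ l x : nrm (l *: x) = normc l * nrm x.
Proof. by apply: complexI; rewrite rmorphM /= -!nrmE normrZ. Qed.

Lemma nrm0 : nrm 0 = 0.
Proof. by apply: complexI; rewrite -nrmE normr0. Qed.

Lemma nrm_eq0 h : nrm h = 0 -> h = 0.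
Proof. by move=> h0; apply/normr0_eq0; rewrite nrmE h0. Qed.

Lemma nrmN x : nrm (- x) = nrm x.
Proof. by apply: complexI; rewrite -!nrmE normrN. Qed.

Lemma nrmB x y : nrm (x - y) <= nrm x + nrm y.
Proof. by rewrite -(nrmN y) nrmD. Qed.

Lemma dotC x y : dot x y = (dot y x)^*%C.
Proof. by rewrite hermC /= expr0 mul1r. Qed.

Lemma dotDl x y h : dot (x + y) h = dot x h + dot y h.
Proof. exact: linearDl. Qed.
Lemma dotDr h x y : dot h (x + y) = dot h x + dot h y.
Proof. exact: linearDr. Qed.
Lemma dotZl l x h : dot (l *: x) h = l * dot x h.
Proof. exact: linearZl_LR. Qed.
Lemma dotZr l x h : dot h (l *: x) = l^*%C * dot h x.
Proof. exact: linearZr_LR. Qed.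
Lemma dotBl x y h : dot (x - y) h = dot x h - dot y h.
Proof. exact: linearBl. Qed.
Lemma dotBr h x y : dot h (x - y) = dot h x - dot h y.
Proof. exact: linearBr. Qed.

Lemma rdotC x y : rdot x y = rdot y x.
Proof. by rewrite /rdot dotC; case: (dot y x). Qed.
Lemma rdotDl x y h : rdot (x + y) h = rdot x h + rdot y h.
Proof. by rewrite /rdot dotDl raddfD. Qed.
Lemma rdotBl x y h : rdot (x - y) h = rdot x h - rdot y h.
Proof. by rewrite /rdot dotBl raddfB. Qed.
Lemma rdotDr h x y : rdot h (x + y) = rdot h x + rdot h y.
Proof. by rewrite /rdot dotDr raddfD. Qed.
Lemma rdotBr h x y : rdot h (x - y) = rdot h x - rdot h y.
Proof. by rewrite /rdot dotBr raddfB. Qed.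
Lemma rdotNl x h : rdot (- x) h = - rdot x h.
Proof. by rewrite /rdot [dot _ _]linearNl raddfN. Qed.
Lemma rdotZl (r : R) x h : rdot (r%:C%C *: x) h = r * rdot x h.
Proof. by rewrite /rdot dotZl; case: (dot x h) => a b /=; rewrite mul0r subr0. Qed.
Lemma rdotZr (r : R) x h : rdot h (r%:C%C *: x) = r * rdot h x.
Proof. by rewrite rdotC rdotZl rdotC. Qed.
Lemma rdotxx h : rdot h h = nrm h ^+ 2.
Proof. by apply: complexI; rewrite rmorphXn /= -nrmE hdot /rdot RRe_real // ger0_real. Qed.

(** The imaginary part is thus controlled by the real form [rdot]. *)
Lemma Im_dot x y : complex.Im (dot x y) = rdot x ('i%C *: y).
Proof. by rewrite /rdot dotZr; case: (dot x y) => a b /=; ring. Qed.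

(** The discriminant of a nonnegative quadratic polynomial. *)
Lemma discr_le (a b c : R) : 0 <= c ->
  (forall t, 0 <= a + 2 * t * b + t ^+ 2 * c) -> b ^+ 2 <= a * c.
Proof.
rewrite le_eqVlt => /orP[/eqP <- q|c0 q].
  have [->|b0] := eqVneq b 0; first by rewrite expr0n mulr0.
  have := q (- (a + 1) / (2 * b)).
  have -> : a + 2 * (- (a + 1) / (2 * b)) * b + (- (a + 1) / (2 * b)) ^+ 2 * 0 = - 1.
    by field.
  by rewrite lerNr oppr0 ler10.
have := q (- b / c).
have -> : a + 2 * (- b / c) * b + (- b / c) ^+ 2 * c = (a * c - b ^+ 2) / c.
  by field; rewrite gt_eqF.
by rewrite pmulr_lge0 ?invr_gt0 // subr_ge0.
Qed.

Lemma rdot_le x y : `|rdot x y| <= nrm x * nrm y.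
Proof.
rewrite -ler_sqr ?nnegrE ?mulr_ge0 ?nrm_ge0 // -normrX ger0_norm ?sqr_ge0 //.
rewrite exprMn; apply: discr_le => [|t]; first exact: sqr_ge0.
have -> : nrm x ^+ 2 + 2 * t * rdot x y + t ^+ 2 * nrm y ^+ 2 =
    rdot (x + t%:C%C *: y) (x + t%:C%C *: y).
  by rewrite rdotDl !rdotDr !rdotZl !rdotZr (rdotC y) !rdotxx; ring.
by rewrite rdotxx sqr_ge0.
Qed.

Lemma normci : normc ('i%C : R[i]) = 1.
Proof. by rewrite /= expr0n expr1n add0r sqrtr1. Qed.

(** The constant [2] comes from treating both parts separately; it is harmless,
    as the bound only serves to prove convergence of matrix coefficients. *)
Lemma dot_le x y : normc (dot x y) <= 2 * (nrm x * nrm y).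
Proof.
have -> : dot x y = (rdot x y +i* rdot x ('i%C *: y))%C.
  by rewrite -Im_dot /rdot; case: (dot x y).
apply: le_trans (normc_le _ _) _; rewrite mulr_natl mulr2n lerD ?rdot_le //.
by rewrite (le_trans (rdot_le _ _)) // nrmZ normci mul1r.
Qed.

Lemma nrm_le_of_sq x (C : R) : 0 <= C -> rdot x x <= C ^+ 2 -> nrm x <= C.
Proof. by move=> C0; rewrite rdotxx ler_sqr ?nnegrE ?nrm_ge0. Qed.

Lemma nondeg x : (forall y, rdot x y = 0) -> x = 0.
Proof.
move=> /(_ x); rewrite rdotxx => /eqP; rewrite sqrf_eq0 => /eqP; exact: nrm_eq0.
Qed.

Lemma dot_ext x y : (forall h, dot x h = dot y h) -> x = y.
Proof.
move=> xy; apply/eqP; rewrite -subr_eq0; apply/eqP/nondeg => h.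
by rewrite rdotBl /rdot xy subrr.
Qed.

Section Limit.
Variables (M : set (H -> H)) (hM : von_neumann_algebra dot M).

Lemma vna_linear f : M f -> linear f.
Proof. by move=> /(vna_bounded hM)[]. Qed.

Lemma bounded_opP f : linear f ->
  (continuous f <-> exists2 C : R, 0 <= C & forall x, nrm (f x) <= C * nrm x).
Proof.
move=> flin; pose fl : {linear H -> H} := HB.pack f (GRing.isLinear.Build _ _ _ _ f flin).
split=> [fc|[C C0 fC]].
  have [K fK] := (bounded_funP fl).2 ((linear_bounded_continuous fl).2 fc) 1.
  exists (Num.max 0 (complex.Re K)) => [|x]; first by rewrite le_max lexx.
  have [->|x0] := eqVneq x 0; first by rewrite -[f 0]/(fl 0) linear0 nrm0 mulr0.
  have nx0 : 0 < nrm x.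
    by rewrite lt_def nrm_ge0 andbT; apply: contra_neq x0; exact: nrm_eq0.
  pose k := ((nrm x)^-1)%:C%C : R[i].
  have nk : nrm (k *: x) = 1.
    by rewrite nrmZ normcR ?invr_ge0 ?(ltW nx0) // mulVf ?gt_eqF.
  have := fK (k *: x); rewrite {1}nrmE nk lexx => /(_ isT).
  rewrite linearZ /= nrmE nrmZ normcR ?invr_ge0 ?(ltW nx0) //.
  rewrite lecE /= => /andP[_]; rewrite mulrC ler_pdivrMr // => h.
  by apply: le_trans h _; rewrite ler_wpM2r ?(ltW nx0) // le_max lexx orbT.
apply/(linear_bounded_continuous fl)/bounded_funP => r; exists (C%:C%C * r) => x xr.
rewrite -[fl x]/(f x) nrmE (le_trans (_ : _ <= (C * nrm x)%:C%C)) ?lecR //.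
by rewrite rmorphM /= -nrmE ler_wpM2l // ler0c.
Qed.

(** Norm completeness of a von Neumann algebra: the pointwise limit of a
    Cauchy sequence is a bounded operator, and its matrix coefficients are the
    limits of those of the sequence, so that weak closedness applies. *)
Lemma vna_limit (u : nat -> H -> H) (e : nat -> R) : (forall n, M (u n)) ->
  (forall n k h, nrm (u (n + k)%N h - u n h) <= e n * nrm h) ->
  (forall d, 0 < d -> exists n, e n <= d) ->
  exists2 f, M f & forall n h, nrm (u n h - f h) <= e n * nrm h.
Proof.
move=> Mu uc e0.
have small h d : 0 < d -> exists n, e n * nrm h <= d.
  move=> d0; have h1 : 0 < nrm h + 1 by have := nrm_ge0 h; lra.
  have [n en] := e0 _ (divr_gt0 d0 h1); exists n.
  apply: le_trans (ler_wpM2r (nrm_ge0 h) en) _.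
  by rewrite -mulrA ger_pMr // mulrC ler_pdivrMr // mul1r lerDl.
have lim h : exists l : H, forall n, nrm (u n h - l) <= e n * nrm h.
  have : cvg ((fun n => u n h) @ \oo).
    apply/cauchy_cvgP/cauchyP => /= eps eps0.
    have [d d0 ->] : exists2 d : R, 0 < d & eps = d%:C%C.
      exists (complex.Re eps); last by rewrite RRe_real // gtr0_real.
      by move: eps0; rewrite ltcE => /andP[].
    have [n en] := small h _ (divr_gt0 d0 (ltr0n R 2)).
    exists (u n h); exists n => // k /= nk.
    rewrite -ball_normE /= nrmE ltcR -opprB nrmN.
    have := uc n (k - n)%N h; rewrite subnKC //; lra.
  move=> /cvg_ex[l ul]; exists l => n; apply/ler_addgt0Pr => d d0.
  have dC : 0 < d%:C%C by rewrite ltcR.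
  move/cvgrPdist_le/(_ _ dC) : ul => [m _ /(_ (n + m)%N (leq_addl _ _))] /=.
  rewrite nrmE lecR => um.
  rewrite -(subrK (u (n + m)%N h) (u n h)) -addrA addrC.
  apply: le_trans (nrmD _ _) _; rewrite [leRHS]addrC lerD //.
    by rewrite -opprB nrmN.
  by rewrite -opprB nrmN uc.
have [f fP] := choice lim; exists f => //.
have eq_small (a b : H) (c : nat -> R) :
    (forall d, 0 < d -> exists n, c n <= d) ->
    (forall n, nrm (a - b) <= c n) -> a = b.
  move=> c0 ab; apply/eqP; rewrite -subr_eq0; apply/eqP/nrm_eq0/le_anti.
  rewrite nrm_ge0 andbT leNgt; apply/negP => ab0.
  have [n cn] := c0 _ (divr_gt0 ab0 (ltr0n R 2)); have := ab n; lra.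
have flin : linear f.
  move=> a x y; set X := a *: x + y.
  pose z := normc a * nrm x + nrm y + nrm X.
  have z0 : 0 <= z by rewrite !addr_ge0 ?mulr_ge0 ?nrm_ge0 ?normc_ge0.
  apply: (@eq_small _ _ (fun n => e n * z)) => [d d0|n].
    have z1 : 0 < z + 1 by lra.
    have [n en] := e0 _ (divr_gt0 d0 z1); exists n.
    apply: le_trans (ler_wpM2r z0 en) _.
    by rewrite -mulrA ger_pMr // mulrC ler_pdivrMr // mul1r lerDl.
  have -> : f X - (a *: f x + f y) =
      a *: (u n x - f x) + (u n y - f y) - (u n X - f X).
    rewrite /X (vna_linear (Mu n)) scalerBr.
    by rewrite [_ - _ + (_ - _)]addrACA -opprD opprB [RHS]addrC [RHS]addrA subrK.
  apply: le_trans (nrmB _ _) _; rewrite /z mulrDr lerD //.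
  apply: le_trans (nrmD _ _) _; rewrite mulrDr lerD //.
  by rewrite nrmZ mulrCA ler_wpM2l ?normc_ge0.
have fcont : continuous f.
  apply/(bounded_opP flin).
  have [n en] := e0 1 ltr01.
  have [C C0 uC] := (bounded_opP (vna_linear (Mu n))).1 (vna_bounded hM (Mu n)).2.
  exists (C + 1) => [|h]; first by rewrite addr_ge0.
  rewrite -(subrK (u n h) (f h)) addrC mulrDl.
  apply: le_trans (nrmD _ _) _; rewrite lerD // -opprB nrmN.
  by apply: le_trans (fP h n) _; rewrite ler_wpM2r ?nrm_ge0.
apply: (vna_closed hM) => // W; rewrite nbhsE => -[U [[V Vop VU] Uf] UW].
have Vf : V (matrix_coeffs dot f) by rewrite -VU in Uf.
pose m n := matrix_coeffs dot (u n).
have mf : m @ \oo --> matrix_coeffs dot f.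
  apply/pointwise_cvgP => -[x y] /=.
  apply/cvgrPdist_le => eps eps0.
  have [d d0 ->] : exists2 d : R, 0 < d & eps = d%:C%C.
    exists (complex.Re eps); last by rewrite RRe_real // gtr0_real.
    by move: eps0; rewrite ltcE => /andP[].
  have c0 : 0 < 4 * (nrm y + 1) by have := nrm_ge0 y; lra.
  have [n en] := small x _ (divr_gt0 d0 c0).
  exists n => // k /= nk.
  rewrite /m /matrix_coeffs /= -dotBl normr_normc lecR.
  apply: le_trans (dot_le _ _) _.
  have : nrm (f x - u k x) <= e n * nrm x + e n * nrm x.
    rewrite -opprB nrmN -(subrK (u n x) (u k x)) -addrA.
    apply: le_trans (nrmD _ _) _; rewrite lerD ?fP //.
    by have := uc n (k - n)%N x; rewrite subnKC.
  have := nrm_ge0 y; have := nrm_ge0 (f x - u k x).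
  by move: en; rewrite ler_pdivlMr //; nra.
have [n _ /(_ n (leqnn n)) Vn] := mf V (open_nbhs_nbhs (conj Vop Vf)).
by exists (u n); split; [exact: Mu | apply: UW; rewrite -VU].
Qed.
End Limit.

End Hilbert.

(** * The algebra of elements of a von Neumann algebra *)

Section OperatorAlgebra.
Context {R : realType} {H : completeNormedModType R[i]}.
Context {dot : {dot H for Num.conj}} {M : set (H -> H)}.

(** The proof that the identity is not [0] is a parameter, because rings with
    unit are required to be nontrivial. *)
Record op (hM : von_neumann_algebra dot M) (ne : (idfun : H -> H) <> 0) :=
  Op { opf :> H -> H; opP : M opf }.

Variables (hM : von_neumann_algebra dot M) (ne : (idfun : H -> H) <> 0).
Local Notation B := (op hM ne).
Implicit Types (x y z : B) (h : H).

Lemma op_ext x y : (forall h, x h = y h) -> x = y.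
Proof.
case: x y => [f Mf] [g Mg] /= /funext fg; move: Mf Mg; rewrite fg => Mf Mg.
by congr Op; apply: Prop_irrelevance.
Qed.

Lemma vna0 : M 0.
Proof. by rewrite -(scale0r (idfun : H -> H)); apply: (vna_scale hM); exact: (vna_id hM). Qed.

Lemma vna_opp f : M f -> M (- f).
Proof. by move=> Mf; rewrite -scaleN1r; apply: (vna_scale hM). Qed.

HB.instance Definition _ := gen_eqMixin B.
HB.instance Definition _ := gen_choiceMixin B.

Definition op0 : B := Op hM ne vna0.
Definition op1 : B := Op hM ne (vna_id hM).
Definition opN x : B := Op hM ne (vna_opp (opP x)).
Definition opD x y : B := Op hM ne (vna_add hM (opP x) (opP y)).
Definition opM x y : B := Op hM ne (vna_comp hM (opP x) (opP y)).
Definition opZ (a : R[i]) x : B := Op hM ne (vna_scale hM a (opP x)).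

Lemma op_linear x : linear x.
Proof. exact: vna_linear hM _ (opP x). Qed.

HB.instance Definition _ x := GRing.isLinear.Build R[i] H H _ (opf x) (op_linear x).

Let opDA : associative opD.
Proof. by move=> x y z; apply: op_ext => h; exact: addrA. Qed.
Let opDC : commutative opD.
Proof. by move=> x y; apply: op_ext => h; exact: addrC. Qed.
Let op0D : left_id op0 opD.
Proof. by move=> x; apply: op_ext => h; exact: add0r. Qed.
Let opND : left_inverse op0 opN opD.
Proof. by move=> x; apply: op_ext => h; exact: addNr. Qed.
HB.instance Definition _ := GRing.isZmodule.Build B opDA opDC op0D opND.

Let opMA : associative opM.
Proof. by move=> x y z; apply: op_ext. Qed.
Let op1M : left_id op1 opM.
Proof. by move=> x; apply: op_ext. Qed.
Let opM1 : right_id op1 opM.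
Proof. by move=> x; apply: op_ext. Qed.
Let opMDl : left_distributive opM +%R.
Proof. by move=> x y z; apply: op_ext. Qed.
Let opMDr : right_distributive opM +%R.
Proof. by move=> x y z; apply: op_ext => h; exact: (linearD (opf x)). Qed.
Let op1_neq0 : op1 != 0.
Proof. by apply/eqP => e; apply: ne; exact: (congr1 (@opf hM ne) e). Qed.
HB.instance Definition _ :=
  GRing.Zmodule_isNzRing.Build B opMA op1M opM1 opMDl opMDr op1_neq0.

Let opZA a b x : opZ a (opZ b x) = opZ (a * b) x.
Proof. by apply: op_ext => h; exact: scalerA. Qed.
Let op1Z : left_id 1 opZ.
Proof. by move=> x; apply: op_ext => h; exact: scale1r. Qed.
Let opZDr : right_distributive opZ +%R.
Proof. by move=> a x y; apply: op_ext => h; exact: scalerDr. Qed.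
Let opZDl x : {morph opZ^~ x : a b / a + b}.
Proof. by move=> a b; apply: op_ext => h; exact: scalerDl. Qed.
HB.instance Definition _ :=
  GRing.Zmodule_isLmodule.Build R[i] B opZA op1Z opZDr opZDl.

Let opZAl (a : R[i]) x y : a *: (x * y) = (a *: x) * y.
Proof. exact: op_ext. Qed.
HB.instance Definition _ := GRing.Lmodule_isLalgebra.Build R[i] B opZAl.
Let opZAr (a : R[i]) x y : a *: (x * y) = x * (a *: y).
Proof. by apply: op_ext => h; rewrite -[RHS]/(x (a *: y h)) linearZ. Qed.
HB.instance Definition _ := GRing.Lalgebra_isAlgebra.Build R[i] B opZAr.

Lemma opDE x y h : (x + y) h = x h + y h. Proof. by []. Qed.
Lemma opNE x h : (- x) h = - x h. Proof. by []. Qed.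
Lemma opBE x y h : (x - y) h = x h - y h. Proof. by []. Qed.
Lemma opME x y h : (x * y) h = x (y h). Proof. by []. Qed.
Lemma opZE (a : R[i]) x h : (a *: x) h = a *: x h. Proof. by []. Qed.
Lemma op1E h : (1 : B) h = h. Proof. by []. Qed.
Lemma op0E h : (0 : B) h = 0. Proof. by []. Qed.
Definition opE := (opBE, opDE, opNE, opME, opZE, op1E, op0E).

Lemma star_ex x : exists y : B, forall h k, dot (x h) k = dot h (y k).
Proof.
by have [f Mf xf] := vna_adjoint hM (opP x); exists (Op hM ne Mf).
Qed.

Definition star x : B := sval (cid (star_ex x)).

Lemma starP x h k : dot (x h) k = dot h (star x k).
Proof. exact: (svalP (cid (star_ex x))). Qed.

Section Norm.
Hypothesis hdot : induces_norm dot.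

Lemma starPl x h k : dot (star x h) k = dot h (x k).
Proof. by rewrite dotC -starP -dotC. Qed.

Lemma star_uniq x y : (forall h k, dot (x h) k = dot h (y k)) -> star x = y.
Proof.
by move=> xy; apply: op_ext => k; apply: (dot_ext hdot) => h;
  rewrite dotC -starP xy -dotC.
Qed.

Lemma starK x : star (star x) = x.
Proof. by apply: star_uniq => h k; rewrite starPl. Qed.
Lemma starM x y : star (x * y) = star y * star x.
Proof. by apply: star_uniq => h k; rewrite !opE !starP. Qed.
Lemma starD x y : star (x + y) = star x + star y.
Proof. by apply: star_uniq => h k; rewrite !opE dotDl dotDr !starP. Qed.
Lemma starZ a x : star (a *: x) = a^*%C *: star x.
Proof. by apply: star_uniq => h k; rewrite !opE dotZl dotZr conjcK starP. Qed.
Lemma starN x : star (- x) = - star x.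
Proof. by rewrite -scaleN1r starZ rmorphN rmorph1 scaleN1r. Qed.
Lemma starB x y : star (x - y) = star x - star y.
Proof. by rewrite starD starN. Qed.
Lemma star1 : star 1 = 1.
Proof. by apply: star_uniq => h k; rewrite !op1E. Qed.
Lemma star0 : star 0 = 0.
Proof. by rewrite -(scale0r 0) starZ rmorph0 !scale0r. Qed.
Lemma starZr (r : R) x : star (r%:C%C *: x) = r%:C%C *: star x.
Proof. by rewrite starZ conjc_real. Qed.

Lemma rstarP x h k : rdot dot (x h) k = rdot dot h (star x k).
Proof. by rewrite /rdot starP. Qed.

Definition opnorm x : R := sup [set nrm (x h) | h in [set h | nrm h <= 1]].

Lemma opnorm_has_sup x : has_sup [set nrm (x h) | h in [set h | nrm h <= 1]].
Proof.
split; first by exists (nrm (x 0)), 0; rewrite //= nrm0.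
have [C C0 xC] := (bounded_opP (op_linear x)).1 (vna_bounded hM (opP x)).2.
exists C => _ [h /= h1 <-]; apply: le_trans (xC h) _.
by rewrite -[leRHS]mulr1 ler_wpM2l.
Qed.

Lemma opnormP x h : nrm (x h) <= opnorm x * nrm h.
Proof.
have [->|h0] := eqVneq h 0; first by rewrite linear0 nrm0 mulr0.
have nh0 : 0 < nrm h.
  by rewrite lt_def nrm_ge0 andbT; apply: contra_neq h0; exact: nrm_eq0.
pose k := ((nrm h)^-1)%:C%C : R[i].
have nk : nrm (k *: h) = 1.
  by rewrite nrmZ normcR ?invr_ge0 ?(ltW nh0) // mulVf ?gt_eqF.
have : nrm (x (k *: h)) <= opnorm x.
  by apply: sup_upper_bound (opnorm_has_sup x) _ _; exists (k *: h); rewrite //= nk.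
rewrite linearZ /= nrmZ normcR ?invr_ge0 ?(ltW nh0) //.
by rewrite ler_pdivrMl // mulrC.
Qed.

Lemma opnorm_le x (C : R) : 0 <= C -> (forall h, nrm (x h) <= C * nrm h) ->
  opnorm x <= C.
Proof.
move=> C0 xC; apply: ge_sup; first by case: (opnorm_has_sup x).
move=> _ [h /= h1 <-]; apply: le_trans (xC h) _.
by rewrite -[leRHS]mulr1 ler_wpM2l.
Qed.

Lemma opnorm_ge0 x : 0 <= opnorm x.
Proof.
apply: le_trans (nrm_ge0 (x 0)) _.
by apply: sup_upper_bound (opnorm_has_sup x) _ _; exists 0; rewrite //= nrm0.
Qed.

Lemma op_nontrivial : exists h : H, h != 0.
Proof.
apply: contrapT => /forallNP all0; apply: ne; apply/funext => h /=.
by have /negP := all0 h; rewrite negbK => /eqP.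
Qed.

Lemma opnorm1 : opnorm 1 = 1.
Proof.
apply/le_anti; rewrite opnorm_le //=; last by move=> h; rewrite mul1r.
have [h h0] := op_nontrivial.
have nh0 : 0 < nrm h.
  by rewrite lt_def nrm_ge0 andbT; apply: contra_neq h0; exact: nrm_eq0.
by have := opnormP 1 h; rewrite opE ler_pMl.
Qed.

Lemma opnorm_eq0 x : opnorm x = 0 -> x = 0.
Proof.
move=> x0; apply: op_ext => h; apply: nrm_eq0; apply/le_anti.
by rewrite nrm_ge0 andbT -(mul0r (nrm h)) -x0 opnormP.
Qed.

Lemma opnorm_banach : banach_norm opnorm.
Proof.
split.
- move=> x y; apply: opnorm_le => [|h]; first by rewrite addr_ge0 ?opnorm_ge0.
  by rewrite mulrDl; apply: le_trans (nrmD _ _) _; rewrite lerD ?opnormP.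
- have le l x : opnorm (l *: x) <= normc l * opnorm x.
    apply: opnorm_le => [|h]; first by rewrite mulr_ge0 ?normc_ge0 ?opnorm_ge0.
    by rewrite opE nrmZ -mulrA ler_wpM2l ?normc_ge0 ?opnormP.
  move=> l x; apply/le_anti; rewrite le /=.
  have [->|l0] := eqVneq l 0.
    by rewrite ComplexField.Normc.normc0 mul0r opnorm_ge0.
  have nl : 0 < normc l.
    rewrite lt_def normc_ge0 andbT; apply: contra_neq l0.
    exact: ComplexField.Normc.eq0_normc.
  rewrite -ler_pdivlMl // -ComplexField.Normc.normcV.
  have {1}-> : x = l^-1 *: (l *: x) by rewrite scalerA mulVf ?scale1r.
  exact: le.
- move=> x y; apply: opnorm_le => [|h]; first by rewrite mulr_ge0 ?opnorm_ge0.
  rewrite opE; apply: le_trans (opnormP _ _) _.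
  by rewrite -mulrA ler_wpM2l ?opnorm_ge0 ?opnormP.
- exact: opnorm1.
- exact: opnorm_eq0.
- move=> u e ue e0.
  have [|f Mf fP] := vna_limit hdot hM (u := fun n => opf (u n)) (e := e) (fun n => opP (u n)) _ e0.
    move=> n k h; rewrite -opBE; apply: le_trans (opnormP _ _) _.
    by rewrite ler_wpM2r ?nrm_ge0.
  exists (Op hM ne Mf) => n; apply: opnorm_le; last exact: fP.
  by apply: le_trans (ue n 0%N); exact: opnorm_ge0.
Qed.

Lemma opnorm_star x : opnorm (star x) = opnorm x.
Proof.
suff le y : opnorm (star y) <= opnorm y.
  by apply/le_anti; rewrite le -{1}(starK x) le.
apply: opnorm_le => [|h]; first exact: opnorm_ge0.
have [->|] := eqVneq (nrm (star y h)) 0.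
  by rewrite mulr_ge0 ?opnorm_ge0 ?nrm_ge0.
move=> n0; have n1 : 0 < nrm (star y h) by rewrite lt_def n0 nrm_ge0.
rewrite -(ler_pM2l n1) -expr2 -(rdotxx hdot) -rstarP.
apply: le_trans (ler_norm _) _; apply: le_trans (rdot_le hdot _ _) _.
rewrite mulrA ler_wpM2r ?nrm_ge0 // mulrC; exact: opnormP.
Qed.

(** [|x^* h| ^ 2 = <x x^* h, h>]. *)
Lemma opnorm_Cstar x : opnorm (x * star x) = opnorm x ^+ 2.
Proof.
apply/le_anti/andP; split.
  by rewrite expr2 -[X in _ <= _ * X]opnorm_star; apply: (bnormM opnorm_banach).
rewrite -[in leLHS]opnorm_star -[leRHS]sqr_sqrtr ?opnorm_ge0 //.
rewrite ler_sqr ?nnegrE ?opnorm_ge0 ?sqrtr_ge0 //.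
apply: opnorm_le => [|h]; first exact: sqrtr_ge0.
apply: (nrm_le_of_sq hdot); first by rewrite mulr_ge0 ?sqrtr_ge0 ?nrm_ge0.
rewrite exprMn sqr_sqrtr ?opnorm_ge0 // -rstarP.
apply: le_trans (ler_norm _) _; apply: le_trans (rdot_le hdot _ _) _.
by rewrite expr2 mulrA ler_wpM2r ?nrm_ge0 // -opME opnormP.
Qed.

End Norm.
End OperatorAlgebra.

(** * Positive elements, square roots and spectral values *)

Section Positive.
Context {R : realType} {H : completeNormedModType R[i]}.
Context {dot : {dot H for Num.conj}} {M : set (H -> H)}.
Context {hM : von_neumann_algebra dot M} {ne : (idfun : H -> H) <> 0}.
Hypothesis hdot : induces_norm dot.
Local Notation B := (op hM ne).
Local Notation rdot := (rdot dot).
Implicit Types (c d e g x y z : B) (h v : H).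
Let hN := opnorm_banach hM ne hdot.

(** Self-adjointness is part of the definition, so that only the real part
    [rdot] of the form has to be considered. *)
Definition pos x := star x = x /\ forall h, 0 <= rdot (x h) h.

Lemma opnormZr (r : R) y : 0 <= r -> opnorm (r%:C%C *: y) = r * opnorm y.
Proof. by move=> r0; rewrite (bnormZ hN) normcR. Qed.

Lemma posZ (r : R) x : 0 <= r -> pos x -> pos (r%:C%C *: x).
Proof.
move=> r0 [sx qx]; split=> [|h]; first by rewrite starZr // sx.
by rewrite opE rdotZl mulr_ge0.
Qed.

Lemma pos_conj g x : pos x -> pos (star g * x * g).
Proof.
move=> [sx qx]; split=> [|h]; first by rewrite !starM // starK // sx mulrA.
by rewrite !opE rdotC -rstarP rdotC.
Qed.

Lemma pos1 : pos 1.
Proof. by split=> [|h]; rewrite ?star1 // opE (rdotxx hdot) sqr_ge0. Qed.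

Lemma pos_star g : pos (star g * g).
Proof. by rewrite -[star g]mulr1; exact: pos_conj pos1. Qed.

Lemma self_quad0 x : star x = x -> (forall h, rdot (x h) h = 0) -> x = 0.
Proof.
move=> sx q; apply: op_ext => h; apply: (nondeg hdot) => k.
have := q (h + k); rewrite linearD rdotDl !rdotDr !q add0r addr0.
by rewrite [rdot (x k) h]rstarP sx (rdotC dot k); lra.
Qed.

(** Cauchy-Schwarz for the form [<c h, k>]. *)
Lemma pos_sq_le c h : pos c -> nrm (c h) ^+ 2 <= opnorm c * rdot (c h) h.
Proof.
move=> [sc qc]; rewrite -(rdotxx hdot).
have b0 : 0 <= rdot (c h) (c h) by rewrite (rdotxx hdot) sqr_ge0.
have le2 : rdot (c (c h)) (c h) <= opnorm c * rdot (c h) (c h).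
  apply: le_trans (ler_norm _) _; apply: le_trans (rdot_le hdot _ _) _.
  by rewrite (rdotxx hdot) expr2 mulrA ler_wpM2r ?nrm_ge0 ?opnormP.
have : rdot (c h) (c h) ^+ 2 <= rdot (c h) h * rdot (c (c h)) (c h).
  apply: discr_le => // t.
  have := qc (h + t%:C%C *: c h).
  rewrite linearD linearZ /= rdotDl !rdotDr !rdotZl !rdotZr.
  by rewrite (rstarP c (c h) h) sc; nra.
have a0 := qc h; have n0 := opnorm_ge0 c.
case: (ltrP 0 (rdot (c h) (c h))) => [bp|bn _]; last by nra.
nra.
Qed.

(** From [|h - k c h| ^ 2 = |h| ^ 2 - 2 k <c h, h> + k ^ 2 |c h| ^ 2] and
    [k |c h| ^ 2 <= <c h, h>]. *)
Lemma pos_contraction c (k : R) : pos c -> 0 <= k -> k * opnorm c <= 1 ->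
  opnorm (1 - k%:C%C *: c) <= 1.
Proof.
move=> pc k0 kc; apply: opnorm_le => // h; rewrite mul1r.
apply: (nrm_le_of_sq hdot); first exact: nrm_ge0.
rewrite !opE rdotBl !rdotBr !rdotZl !rdotZr (rdotC dot h) !(rdotxx hdot).
have q0 := pc.2 h; have cq := pos_sq_le h pc.
have h1 : k * nrm (c h) ^+ 2 <= rdot (c h) h.
  apply: le_trans (ler_wpM2l k0 cq) _; rewrite mulrA.
  by rewrite -[leRHS]mul1r ler_wpM2r.
have := ler_wpM2l k0 h1; have := mulr_ge0 k0 q0; lra.
Qed.

(** [r + c] is a multiple of [(k r + 1) - (1 - k c)], a scalar above [1] minus
    a contraction. *)
Lemma pos_shift_inverse c (r : R) : pos c -> 0 < r ->
  has_inverse (r%:C%C *: 1 + c).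
Proof.
move=> pc r0; have n0 := opnorm_ge0 c.
have k0 : 0 < (opnorm c + 1)^-1 by rewrite invr_gt0; lra.
set k := _^-1 in k0; have kC : k%:C%C != 0 :> R[i] by rewrite eq_complex /= gt_eqF.
have -> : r%:C%C *: 1 + c =
    (k%:C%C)^-1 *: ((k * r + 1)%:C%C *: 1 - (1 - k%:C%C *: c)).
  have -> : (k * r + 1)%:C%C *: 1 - (1 - k%:C%C *: c) =
      k%:C%C *: (r%:C%C *: 1 + c).
    rewrite rmorphD rmorphM rmorph1 scalerDl scale1r scalerDr scalerA.
    by rewrite opprB addrA addrAC addrK.
  by rewrite scalerA mulVf // scale1r.
apply: has_inverseZ; first by rewrite invr_eq0.
apply: (neumann hN); apply: le_lt_trans (_ : 1 < _).
  apply: pos_contraction => //; first exact: ltW.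
  by rewrite /k mulrC ler_pdivrMr; lra.
by have kr := mulr_gt0 k0 r0; rewrite normcR; lra.
Qed.

(** Substituting [v = d w] in [|d^-1 v|^2 <= N (d^-1) <d^-1 v, v>]. *)
Lemma inverse_coercive d y : pos d -> d * y = 1 -> y * d = 1 ->
  pos y /\ forall v, nrm v ^+ 2 <= opnorm y * rdot (d v) v.
Proof.
move=> [sd qd] dy yd.
have py : pos y.
  split=> [|h].
    rewrite -[LHS]mulr1 -dy mulrA.
    have -> : star y * d = 1 by rewrite -sd -starM // dy star1.
    by rewrite mul1r.
  have {2}-> : h = d (y h) by rewrite -opME dy.
  by rewrite rdotC.
split=> // v; have := pos_sq_le (d v) py.
by rewrite -opME yd op1E (rdotC dot v).
Qed.

(** If [|c| - c] were invertible it would be bounded below by a positive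
    constant [t], and then [c <= |c| - t] would have too small a norm. *)
Lemma norm_in_spectrum c : pos c -> c != 0 ->
  ~ has_inverse ((opnorm c)%:C%C *: 1 - c).
Proof.
move=> pc c0; set r := opnorm c => -[y dy yd].
have r0 : 0 < r.
  by rewrite lt_def opnorm_ge0 andbT; apply: contra_neq c0; apply: opnorm_eq0.
have dE h : rdot (((opnorm c)%:C%C *: 1 - c) h) h = r * nrm h ^+ 2 - rdot (c h) h.
  by rewrite !opE rdotBl rdotZl (rdotxx hdot).
have pd : pos ((opnorm c)%:C%C *: 1 - c).
  split=> [|h]; first by rewrite starB // starZr // star1 // pc.1.
  rewrite dE subr_ge0; apply: le_trans (ler_norm _) _.
  apply: le_trans (rdot_le hdot _ _) _.
  by rewrite expr2 mulrA ler_wpM2r ?nrm_ge0 ?opnormP.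
have [_ yq] := inverse_coercive pd dy yd.
have y0 : 0 < opnorm y.
  rewrite lt_def opnorm_ge0 andbT; apply/negP => /eqP/opnorm_eq0 y0.
  by move/eqP: dy; rewrite y0 mulr0 eq_sym oner_eq0.
pose t := (opnorm y)^-1; have t0 : 0 < t by rewrite invr_gt0.
have cq v : rdot (c v) v <= (r - t) * nrm v ^+ 2.
  have := yq v; rewrite dE -ler_pdivrMl // -/t; lra.
have rt : 0 <= r - t.
  have [h h0] := op_nontrivial ne; have := cq h; have := pc.2 h.
  have n0 : 0 < nrm h.
    by rewrite lt_def nrm_ge0 andbT; apply: contra_neq h0; exact: nrm_eq0.
  have : 0 < nrm h ^+ 2 by rewrite exprn_gt0.
  by move=> *; nra.
have : r <= Num.sqrt (r * (r - t)).
  apply: opnorm_le => [|h]; first exact: sqrtr_ge0.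
  apply: (nrm_le_of_sq hdot); first by rewrite mulr_ge0 ?sqrtr_ge0 ?nrm_ge0.
  rewrite exprMn sqr_sqrtr; last by rewrite mulr_ge0 ?(ltW r0).
  rewrite (rdotxx hdot); apply: le_trans (pos_sq_le h pc) _.
  by rewrite -mulrA ler_wpM2l // ltW.
have rr : 0 <= r * (r - t) by rewrite mulr_ge0 ?(ltW r0).
move=> h; have := sqr_sqrtr rr; have := sqrtr_ge0 (r * (r - t)).
set q := Num.sqrt _ in h *; nra.
Qed.

(** The iteration [y := (x + y ^ 2) / 2] for [1 - sqrt (1 - x)] is dominated,
    in norm, by the same iteration [sqrt_bound] at the scalar [x = 1]. *)
Section SquareRoot.
Variable x : B.
Hypothesis x1 : opnorm x <= 1.
Hypothesis sx : star x = x.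

Fixpoint sqrt_iter n : B :=
  if n is n'.+1 then (2^-1)%:C%C *: (x + sqrt_iter n' * sqrt_iter n') else 0.

Fixpoint sqrt_bound n : R :=
  if n is n'.+1 then 2^-1 * (1 + sqrt_bound n' ^+ 2) else 0.

Lemma sqrt_bound_itv n : 0 <= sqrt_bound n <= 1.
Proof.
elim: n => [|n /andP[a b]] /=; first by rewrite lexx ler01.
by apply/andP; split; nra.
Qed.

(** The defect [q = 1 - sqrt_bound n] evolves by [q - q ^ 2 / 2], hence decays
    like [2 / n]. *)
Lemma sqrt_bound_near1 n : 1 - sqrt_bound n <= 2 / n.+2%:R.
Proof.
elim: n => [|n IH] /=; first by rewrite subr0 mulfV.
have /andP[a b] := sqrt_bound_itv n.
have n2 : 0 < n.+2%:R :> R by rewrite ltr0n.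
have n3 : 0 < n.+3%:R :> R by rewrite ltr0n.
move: IH; set q := sqrt_bound n in a b *; rewrite !ler_pdivlMr // => IH.
have e3 : n.+3%:R = n.+2%:R + 1 :> R by rewrite -natr1.
rewrite e3; set p := n.+2%:R in n2 IH *.
have e1 : 0 <= 1 - q by lra.
have p2 : 2 <= p by rewrite /p ler_nat.
have : (1 - q) * (1 + q) * (p + 1) <= 4.
  have : 1 + q <= 2 by lra.
  nra.
nra.
Qed.

Lemma sqrt_iter_comm z n : z * x = x * z -> z * sqrt_iter n = sqrt_iter n * z.
Proof.
move=> zx; elim: n => [|n IH] /=; first by rewrite mulr0 mul0r.
rewrite -scalerAr -scalerAl mulrDr mulrDl zx; congr (_ *: (_ + _)).
by rewrite mulrA IH -mulrA IH mulrA.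
Qed.

Lemma sqrt_iter_commute m n : sqrt_iter m * sqrt_iter n = sqrt_iter n * sqrt_iter m.
Proof. by apply: sqrt_iter_comm; rewrite sqrt_iter_comm. Qed.

Lemma sqrt_iter_star n : star (sqrt_iter n) = sqrt_iter n.
Proof.
elim: n => [|n IH] /=; first exact: star0.
by rewrite starZr // starD // starM // IH sx.
Qed.

Lemma sqrt_iter_norm n : opnorm (sqrt_iter n) <= sqrt_bound n.
Proof.
elim: n => [|n IH] /=; first by rewrite (bnorm0 hN).
rewrite opnormZr // ler_wpM2l // (le_trans (bnormD hN _ _)) // lerD //.
apply: le_trans (bnormM hN _ _) _; rewrite expr2.
by apply: ler_pM; rewrite ?opnorm_ge0.
Qed.

(** [a ^ 2 - b ^ 2 = (a + b) (a - b)] for commuting [a], [b], both for the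
    iterates and for their scalar bounds. *)
Lemma sqrt_iter_cauchy n k :
  opnorm (sqrt_iter (n + k)%N - sqrt_iter n) <= sqrt_bound (n + k)%N - sqrt_bound n.
Proof.
elim: n => [|n IH]; first by rewrite !subr0 sqrt_iter_norm.
rewrite addSn /=; set a := sqrt_iter _ in IH *; set b := sqrt_iter n in IH *.
have -> : (2^-1)%:C%C *: (x + a * a) - (2^-1)%:C%C *: (x + b * b) =
    (2^-1)%:C%C *: ((a + b) * (a - b)).
  rewrite -scalerBr opprD addrACA subrr add0r; congr (_ *: _).
  rewrite mulrDl !mulrBr addrA -[a * b]sqrt_iter_commute -/a -/b.
  by rewrite subrK.
rewrite opnormZr // -mulrBr ler_wpM2l //.
have -> : 1 + sqrt_bound (n + k) ^+ 2 - (1 + sqrt_bound n ^+ 2) =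
  (sqrt_bound (n + k) + sqrt_bound n) * (sqrt_bound (n + k) - sqrt_bound n) by ring.
apply: le_trans (bnormM hN _ _) _; apply: ler_pM; rewrite ?opnorm_ge0 //.
by apply: le_trans (bnormD hN _ _) _; rewrite lerD ?sqrt_iter_norm.
Qed.

Lemma sqrt_contraction : exists y, [/\ star y = y, opnorm y <= 1,
  2%:R *: y = x + y * y & forall z, z * x = x * z -> z * y = y * z].
Proof.
pose e n : R := 2 / n.+2%:R.
have e0 (d : R) : 0 < d -> exists n, e n <= d.
  move=> d0; exists (Num.truncn (2 / d)).
  rewrite /e ler_pdivrMr ?ltr0n // mulrC -ler_pdivrMr //.
  by apply: le_trans (ltW (truncnS_gt _)) _; rewrite ler_nat.
have ue n k : opnorm (sqrt_iter (n + k)%N - sqrt_iter n) <= e n.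
  apply: le_trans (sqrt_iter_cauchy _ _) _.
  have h1 : 1 - sqrt_bound n <= e n := sqrt_bound_near1 n.
  have /andP[_ h2] := sqrt_bound_itv (n + k)%N.
  by apply: le_trans h1; rewrite lerD2r.
have [y uy] := bnorm_complete hN ue e0.
have ep n : 0 <= e n by rewrite divr_ge0.
have eS n : e n.+1 <= e n.
  by rewrite /e ler_pM2l // lef_pV2 ?posrE ?ltr0n // ler_nat.
have y1 : opnorm y <= 1.
  apply/ler_addgt0Pr => d d0; have [n en] := e0 _ d0.
  rewrite -[y](subKr (sqrt_iter n)); apply: le_trans (bnormB hN _ _) _.
  have := uy n; have := sqrt_iter_norm n; have /andP[_] := sqrt_bound_itv n; lra.
have u1 n : opnorm (sqrt_iter n) <= 1.
  have := sqrt_iter_norm n; have /andP[_] := sqrt_bound_itv n; lra.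
exists y; split=> //.
- apply/eqP; rewrite -subr_eq0; apply/eqP.
  apply: (small_eq0 hN (C := 2) (e := e)) => // n.
  rewrite -(subrK (sqrt_iter n) (star y)) -addrA.
  apply: le_trans (bnormD hN _ _) _; rewrite mulrDl mul1r lerD //.
  by rewrite -[sqrt_iter n]sqrt_iter_star -starB // opnorm_star // (bnorm_sym hN).
- apply/eqP; rewrite -subr_eq0; apply/eqP.
  apply: (small_eq0 hN (C := 4) (e := e)) => // n.
  set s := sqrt_iter n.
  have sE : 2%:R *: sqrt_iter n.+1 = x + s * s.
    rewrite /= scalerA -(rmorph_nat (real_complex R)) -rmorphM /= mulfV //.
    by rewrite scale1r.
  have -> : 2%:R *: y - (x + y * y) =
      - (2%:R *: (sqrt_iter n.+1 - y)) + (s * (s - y) + (s - y) * y).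
    have -> : s * (s - y) + (s - y) * y = s * s - y * y.
      by rewrite mulrBr mulrBl addrA subrK.
    rewrite scalerBr sE opprB -[RHS]addrA; congr (_ + _).
    by rewrite !opprD [RHS]addrA subrK.
  apply: le_trans (bnormD hN _ _) _; rewrite (bnormN hN) (bnormZ hN).
  rewrite -(rmorph_nat (real_complex R)) normcR //.
  apply: le_trans (lerD (lexx _) (bnormD hN _ _)) _.
  have h1 := uy n.+1; have h2 := uy n; have h3 := eS n.
  have h4 : opnorm (s * (s - y)) <= e n.
    apply: le_trans (bnormM hN _ _) _; rewrite -[leRHS]mul1r.
    exact: ler_pM (opnorm_ge0 _) (opnorm_ge0 _) (u1 n) h2.
  have h5 : opnorm ((s - y) * y) <= e n.
    apply: le_trans (bnormM hN _ _) _; rewrite -[leRHS]mulr1.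
    exact: ler_pM (opnorm_ge0 _) (opnorm_ge0 _) h2 y1.
  lra.
move=> z zx; apply/eqP; rewrite -subr_eq0; apply/eqP.
apply: (small_eq0 hN (C := 2 * opnorm z) (e := e)) => // [|n].
  by rewrite mulr_ge0 ?opnorm_ge0.
have -> : z * y - y * z = (sqrt_iter n - y) * z - z * (sqrt_iter n - y).
  by rewrite mulrBl mulrBr sqrt_iter_comm // opprB [RHS]addrC [RHS]addrA subrK.
apply: le_trans (bnormB hN _ _) _; rewrite -mulrA mulr_natl mulr2n lerD //.
  apply: le_trans (bnormM hN _ _) _; rewrite mulrC.
  exact: ler_pM (opnorm_ge0 _) (opnorm_ge0 _) (lexx _) (uy n).
apply: le_trans (bnormM hN _ _) _.
exact: ler_pM (opnorm_ge0 _) (opnorm_ge0 _) (lexx _) (uy n).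
Qed.

End SquareRoot.

(** With [y] the limit of the iteration for [x = 1 - c / (N c + 1)], one has
    [(1 - y) ^ 2 = 1 - x]. *)
Lemma pos_sqrt c : pos c -> exists e, [/\ pos e, e * e = c &
  forall z, z * c = c * z -> z * e = e * z].
Proof.
move=> pc; have n0 := opnorm_ge0 c.
have k0 : 0 < opnorm c + 1 by lra.
pose k := Num.sqrt (opnorm c + 1); have kp : 0 < k by rewrite sqrtr_gt0.
have kk : k * k = opnorm c + 1 by rewrite -expr2 sqr_sqrtr // ltW.
pose x := 1 - ((opnorm c + 1)^-1)%:C%C *: c.
have x1 : opnorm x <= 1.
  apply: pos_contraction => //; first by rewrite invr_ge0 ltW.
  by rewrite mulrC ler_pdivrMr; lra.
have sx : star x = x by rewrite starB // star1 // starZr // pc.1.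
have [y [sy y1 ye yc]] := sqrt_contraction x1 sx.
exists (k%:C%C *: (1 - y)); split.
- apply: posZ (ltW kp) _; split=> [|h]; first by rewrite starB // star1 // sy.
  rewrite !opE rdotBl (rdotxx hdot) subr_ge0.
  apply: le_trans (ler_norm _) _; apply: le_trans (rdot_le hdot _ _) _.
  rewrite expr2 ler_wpM2r ?nrm_ge0 //.
  by apply: le_trans (opnormP _ _) _; rewrite ler_piMl ?nrm_ge0.
- rewrite -scalerAl -scalerAr scalerA -rmorphM /= kk.
  have -> : (1 - y) * (1 - y) = 1 - x.
    rewrite mulrBr mulr1 mulrBl mul1r opprB.
    have -> : y * y - y = y - x.
      have -> : y * y = 2%:R *: y - x by rewrite ye addrC addKr.
      by rewrite scaler_nat mulr2n addrAC addrK.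
    by rewrite addrA subrK.
  by rewrite subKr scalerA -rmorphM /= mulfV ?gt_eqF // scale1r.
move=> z zc; rewrite -scalerAr -scalerAl mulrBr mulrBl mulr1 mul1r yc //.
by rewrite /x mulrBr mulrBl mulr1 mul1r -scalerAr -scalerAl zc.
Qed.

Lemma self_abs d : star d = d -> exists e, [/\ pos e, e * e = d * d &
  forall z, z * d = d * z -> z * e = e * z].
Proof.
move=> sd; have := pos_star d; rewrite sd => /pos_sqrt[e [pe ee ec]].
by exists e; split=> // z zd; apply: ec; rewrite mulrA zd -mulrA zd mulrA.
Qed.

End Positive.

(** * Linear dependence in prime algebras *)

Section Prime.
Context {R : realType} {H : completeNormedModType R[i]}.
Context {dot : {dot H for Num.conj}} {M : set (H -> H)}.
Context {hM : von_neumann_algebra dot M} {ne : (idfun : H -> H) <> 0}.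
Hypothesis hdot : induces_norm dot.
Local Notation B := (op hM ne).
Local Notation rdot := (rdot dot).
Implicit Types (a b d e g s t w x y z : B) (h v : H).
Let hN := opnorm_banach hM ne hdot.

Lemma pos_quad0 e h : pos e -> rdot (e h) h = 0 -> e h = 0.
Proof.
move=> pe eh; apply/nrm_eq0/eqP; rewrite -sqrf_eq0; apply/eqP/le_anti.
by rewrite sqr_ge0 andbT; have := pos_sq_le hdot h pe; rewrite eh mulr0.
Qed.

Lemma conj_eq0 e w : pos e -> star w * e * w = 0 -> e * w = 0.
Proof.
move=> pe ewe; apply: op_ext => h; rewrite !opE; apply: pos_quad0 => //.
by rewrite rdotC rstarP rdotC -!opME ewe op0E /rdot linear0l.
Qed.

Lemma star_mul_eq0 t : star t * t = 0 -> t = 0.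
Proof. by move=> tt; rewrite -[t]mul1r; apply: conj_eq0 (pos1 hdot) _; rewrite mulr1. Qed.

(** With [m = w^* e w] and [k = w^* g] the hypothesis gives
    [g g^* m = - e k k^*]. Up to [0], the left side has the spectrum of
    [g^* m g >= 0] and the right side that of [- k^* e k <= 0]. *)
Lemma opposite_sides_eq0 e g w : pos e ->
  e * w * (g * star g) = - (g * star g * w * e) -> e * w * g = 0.
Proof.
move=> pe ewa; rewrite -mulrA; apply: conj_eq0 => //.
set c := star _ * e * _; have pc : pos c by apply: pos_conj.
apply/eqP; rewrite -[_ == _]negbK; apply/negP => c0.
apply: (norm_in_spectrum hdot pc c0).
have r0 : 0 < opnorm c.
  by rewrite lt_def opnorm_ge0 andbT; apply: contra_neq c0; apply: opnorm_eq0.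
have rC : (opnorm c)%:C%C != 0 :> R[i] by rewrite eq_complex /= gt_eqF.
have cE : c = (star g * star w * e * w) * g by rewrite /c starM // !mulrA.
move: (opnorm c) r0 rC => r r0 rC; rewrite cE; apply: has_inverse_swap => //.
have adj : g * star g * star w * e = - (e * star w * (g * star g)).
  have := congr1 (@star _ _ _ _ hM ne) ewa; rewrite starN // !starM // !starK // pe.1.
  by rewrite !mulrA.
pose k := star w * g.
have -> : g * (star g * star w * e * w) = (e * k) * (- star k).
  by rewrite !mulrA adj /k starM // starK // mulrN mulNr !mulrA.
apply: has_inverse_swap => //; rewrite mulNr opprK mulrA.
by apply: pos_shift_inverse => //; exact: pos_conj.
Qed.

Hypothesis hprime : forall a b, (forall m, a * m * b = 0) -> a = 0 \/ b = 0.

(** The parts [p = |d| + d] and [q = |d| - d] satisfy [d p = |d| p] and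
    [d q = - |d| q], so that [w = p x q] falls under the preceding lemma for
    every [x]; primeness then kills one of the two parts. *)
Lemma self_definite d g : g != 0 -> star d = d ->
  (forall x, d * x * (g * star g) = g * star g * x * d) -> pos d \/ pos (- d).
Proof.
move=> g0 sd dxa; have [e [pe ee ec]] := self_abs hdot sd.
have ed : d * e = e * d by apply: ec.
pose p := e + d; pose q := e - d.
have dp : d * p = e * p by rewrite /p !mulrDr ed ee addrC.
have qd : q * d = - (q * e) by rewrite /q !mulrBl ed -ee opprB.
have sq : star q = q by rewrite /q starB // sd pe.1.
have sp : star p = p by rewrite /p starD // sd pe.1.
have pxqg x : e * p * x * (q * g) = 0.
  have : e * (p * x * q) * (g * star g) = - (g * star g * (p * x * q) * e).
    have := dxa (p * x * q).
    have -> : d * (p * x * q) = e * (p * x * q) by rewrite !mulrA dp.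
    have -> : g * star g * (p * x * q) * d = - (g * star g * (p * x * q) * e).
      by rewrite -!mulrA qd !mulrN !mulrA.
    by [].
  by move/(opposite_sides_eq0 pe); rewrite !mulrA.
have [ep|qg] := hprime pxqg.
  right; have : p = 0.
    apply: star_mul_eq0; rewrite sp {1}/p mulrDl dp ep addr0 //.
  by rewrite /p => /eqP; rewrite addr_eq0 => /eqP <-.
left; suff : q = 0 by rewrite /q => /eqP; rewrite subr_eq0 => /eqP <-.
have aq : g * star g * q = 0.
  by rewrite -mulrA -sq -starM // qg star0 // mulr0.
have aqe x : g * star g * x * (q * e) = 0.
  have dq : d * q = - (q * e).
    by rewrite /q mulrBr mulrBl ed -ee opprB.
  by rewrite -[_ * e]opprK -dq mulrN !mulrA -dxa -!mulrA [g * _]mulrA aq !mulr0 oppr0.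
have [a0|qe] := hprime aqe.
  case/eqP: g0; rewrite -[g](starK hdot) [star g]star_mul_eq0 ?star0 //.
  by rewrite starK.
apply: star_mul_eq0; rewrite sq {2}/q mulrBr qd qe !oppr0 addr0 //.
Qed.

(** For [h] with [<a h, h> > 0], the form of [d = b - m a] at [h] is positive
    for [m] below [r = <b h, h> / <a h, h>] and negative above, which decides
    the sign of [d]; letting [m] tend to [r] leaves [b = r a]. *)
Lemma self_proportional b g : g != 0 -> star b = b ->
  (forall x, b * x * (g * star g) = g * star g * x * b) ->
  exists r : R, b = r%:C%C *: (g * star g).
Proof.
move=> g0 sb bxa; set a := g * star g in bxa *.
have pa : pos a by rewrite /a -{1}(starK hdot g); apply: pos_star.
have a0 : a != 0.
  apply: contra_neq g0; rewrite /a -{1}(starK hdot g) => /star_mul_eq0 g0.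
  by rewrite -(starK hdot g) g0 star0.
have [h ah] : exists h, 0 < rdot (a h) h.
  apply: contrapT => /forallNP all0; case/eqP: a0; apply: self_quad0 => //.
    exact: pa.1.
  move=> h; apply/le_anti; rewrite pa.2 andbT leNgt; apply/negP; exact: all0.
pose r := rdot (b h) h / rdot (a h) h; exists r.
have rE : r * rdot (a h) h = rdot (b h) h by rewrite divfK // gt_eqF.
pose dd (m : R) := b - m%:C%C *: a.
have ddE m k : rdot (dd m k) k = rdot (b k) k - m * rdot (a k) k.
  by rewrite /dd !opE rdotBl rdotZl.
have ddN m k : rdot ((- dd m) k) k = - rdot (dd m k) k.
  by rewrite opNE rdotNl.
have def m : pos (dd m) \/ pos (- dd m).
  apply: (self_definite g0); first by rewrite /dd starB // sb starZr // pa.1.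
  move=> x; rewrite /dd -/a !mulrBl mulrBr bxa -!scalerAl -scalerAr.
  by rewrite mulrA.
apply/eqP; rewrite -subr_eq0; apply/eqP; apply: self_quad0 => //.
  by rewrite starB // sb starZr // pa.1.
move=> k; rewrite -/(dd r) ddE.
have lo m : m < r -> 0 <= rdot (b k) k - m * rdot (a k) k.
  move=> mr; case: (def m) => [[_ /(_ k)]|[_ /(_ h)]]; first by rewrite ddE.
  by rewrite ddN ddE -rE; nra.
have hi m : r < m -> rdot (b k) k - m * rdot (a k) k <= 0.
  move=> mr; case: (def m) => [[_ /(_ h)]|[_ /(_ k)]].
    by rewrite ddE -rE; nra.
  by rewrite ddN ddE; lra.
have ak := pa.2 k; set X := rdot (b k) k in lo hi *; set A := rdot (a k) k in ak lo hi *.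
apply/eqP; rewrite -[_ == _]negbK; apply/negP => X0.
have X1 : 0 < `|X - r * A| by rewrite normr_gt0.
pose dl := `|X - r * A| / (2 * (A + 1)).
have d0 : 0 < dl by rewrite divr_gt0 // mulr_gt0 // ltr_wpDl.
have dE : dl * (2 * (A + 1)) = `|X - r * A|.
  by rewrite divfK // gt_eqF // mulr_gt0 // ltr_wpDl.
have := lo (r - dl) ltac:(lra); have := hi (r + dl) ltac:(lra).
by have [h1|h1] := lerP 0 (X - r * A); move: dE;
  [rewrite ger0_norm //|rewrite ltr0_norm //]; nra.
Qed.

(** For [a = t^* t] and [b = t^* s] one has [b x a = a x b], also for the real
    and imaginary parts of [b]; hence [t^* (s - l t) = 0] for some [l]. *)
Lemma commute_proportional s t : t != 0 ->
  (forall x, t * x * s = s * x * t) -> exists l : R[i], s = l *: t.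
Proof.
move=> t0 tsx; pose a := star t * t; pose b := star t * s.
have g0 : star t != 0.
  by apply: contra_neq t0 => t0; rewrite -(starK hdot t) t0 star0.
have aE : star t * star (star t) = a by rewrite starK.
have bxa x : b * x * a = a * x * b.
  have := tsx (x * star t); rewrite /a /b !mulrA => e.
  have -> : star t * s * x * star t * t = star t * (s * x * star t * t).
    by rewrite !mulrA.
  by rewrite -e !mulrA.
have sbxa x : star b * x * a = a * x * star b.
  have sa : star a = a by rewrite /a starM // starK.
  have := congr1 (@star _ _ _ _ hM ne) (bxa (star x)).
  rewrite (starM hdot (b * star x) a) (starM hdot b) (starM hdot (a * star x) b).
  by rewrite (starM hdot a) !(starK hdot x) sa !mulrA.
have [|x|r1 b1] := @self_proportional (b + star b) (star t) g0.
- by rewrite starD // starK // addrC.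
- by rewrite aE !mulrDl mulrDr bxa sbxa.
have [|x|r2 b2] := @self_proportional ('i%C *: (b - star b)) (star t) g0.
- rewrite starZ // starB // starK //.
  have -> : ('i%C : R[i])^*%C = - 'i%C by apply/eqP; rewrite eq_complex /= oppr0 !eqxx.
  by rewrite scaleNr -scalerN opprB.
- by rewrite aE -!scalerAl -scalerAr !mulrBl mulrBr bxa sbxa -?scalerAl.
rewrite aE in b1 b2.
pose l : R[i] := 2^-1 * (r1%:C%C - 'i%C * r2%:C%C).
have bE : b = l *: a.
  have i2 : 'i%C * 'i%C = -1 :> R[i] by rewrite -expr2 sqr_i.
  have b3 : b - star b = (- 'i%C * r2%:C%C) *: a.
    by rewrite -scalerA -b2 scalerA mulNr i2 opprK scale1r.
  have : b + b = (r1%:C%C - 'i%C * r2%:C%C) *: a.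
    by rewrite scalerBl -b1 -scaleNr -mulNr -b3 addrACA subrr addr0.
  rewrite -mulr2n -scaler_nat => /(congr1 (fun x => (2^-1 : R[i]) *: x)).
  by rewrite !scalerA mulVf ?scale1r // pnatr_eq0.
exists l; apply/eqP; rewrite -subr_eq0; apply/eqP.
pose u := s - l *: t.
have tu : star t * u = 0 by rewrite mulrBr -scalerAr -/a -/b bE subrr.
have txu x : t * x * u = u * x * t.
  by rewrite mulrBr !mulrBl tsx -scalerAr -!scalerAl.
have [x|a0|//] := @hprime (star t * t) u.
  by rewrite -!mulrA [t * _]mulrA txu !mulrA tu !mul0r.
by case/eqP: t0; apply: star_mul_eq0.
Qed.

(** The scalar is at most [1] in modulus by the case [z = y = 1]. *)
Theorem dominated_proportional s t :
  (forall z y, opnorm (z * s * y) <= opnorm (z * t * y)) ->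
  exists l : R[i], normc l <= 1 /\ s = l *: t.
Proof.
move=> st; have st1 : opnorm s <= opnorm t by have := st 1 1; rewrite !mul1r !mulr1.
have [t0|t0] := eqVneq t 0.
  exists 0; rewrite ComplexField.Normc.normc0 ler01 scale0r; split=> //.
  apply: opnorm_eq0; apply/le_anti; rewrite opnorm_ge0 andbT.
  by apply: le_trans st1 _; rewrite t0 (bnorm0 hN).
have [l sl] := commute_proportional t0 (dominated_commute hN st).
exists l; split=> //; move: st1; rewrite sl (bnormZ hN) ger_pMl //.
by rewrite lt_def opnorm_ge0 andbT; apply: contra_neq t0; apply: opnorm_eq0.
Qed.

End Prime.

(** * The support projection *)

Section Support.
Context {R : realType} {H : completeNormedModType R[i]}.
Context {dot : {dot H for Num.conj}} {M : set (H -> H)}.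
Context {hM : von_neumann_algebra dot M} {ne : (idfun : H -> H) <> 0}.
Hypothesis hdot : induces_norm dot.
Local Notation B := (op hM ne).
Local Notation rdot := (rdot dot).
Implicit Types (a d e p x y z : B) (h v : H).
Let hN := opnorm_banach hM ne hdot.

(** Polarization over the complex numbers, by testing [h + k] and [h + i k]. *)
Lemma quad0 d : (forall h, dot (d h) h = 0) -> d = 0.
Proof.
move=> q; apply: op_ext => h; apply: (dot_ext hdot) => k.
rewrite op0E linear0l.
have cross u v : dot (d u) v = - dot (d v) u.
  have := q (u + v); rewrite [opf d _]linearD (dotDl dot) !(dotDr dot) !q add0r addr0 => /eqP.
  by rewrite addr_eq0 => /eqP.
have := cross h ('i%C *: k); rewrite [opf d (_ *: _)]linearZ /= (dotZl dot) (dotZr dot) cross.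
have -> : ('i%C : R[i])^*%C = - 'i%C by apply/eqP; rewrite eq_complex /= oppr0 !eqxx.
rewrite mulrNN => /eqP; rewrite -addr_eq0 -mulr2n -mulrnAr mulf_eq0.
by rewrite mulrn_eq0 /= eq_complex /= oner_eq0 andbF /= => /eqP ->; rewrite oppr0.
Qed.

Lemma pos_of_positive_operator a : positive_operator dot a -> pos a.
Proof.
move=> ap; split=> [|h]; last by have := ap h; rewrite lecE /= => /andP[].
apply/eqP; rewrite eq_sym -subr_eq0; apply/eqP/quad0 => h.
rewrite opBE (dotBl dot) starPl //; have := ap h; rewrite (dotC dot h) lecE /=.
case: (dot _ _) => u v /= /andP[/eqP-> _]; rewrite oppr0; exact: subrr.
Qed.

(** Let [x = a - r] and [N = |y|]. Since [N ^ 2] is a spectral value of [y ^ 2],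
    one of [N - y], [N + y] is not invertible, that is [r + k / N] is a spectral
    value of [a] with [k = 1] or [k = - 1]; the gap excludes this if
    [1 / N < r]. *)
Lemma inverse_norm_le a y (r : R) : 0 < r -> pos a ->
  (forall l : R[i], l != 0 -> normc l < r *+ 2 -> has_inverse (l *: 1 - a)) ->
  (a - r%:C%C *: 1) * y = 1 -> y * (a - r%:C%C *: 1) = 1 -> opnorm y <= r^-1.
Proof.
move=> r0 pa gap xy yx; set x := a - _ in xy yx.
have sx : star x = x by rewrite starB // starZr // star1 // pa.1.
have sy : star y = y.
  rewrite -[LHS]mulr1 -xy mulrA.
  have -> : star y * x = 1 by rewrite -sx -starM // xy star1.
  by rewrite mul1r.
have y0 : y != 0.
  by apply/eqP => y0; move/eqP: xy; rewrite y0 mulr0 eq_sym oner_eq0.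
have n0 : 0 < opnorm y.
  by rewrite lt_def opnorm_ge0 andbT; apply: contra_neq y0; apply: opnorm_eq0.
rewrite leNgt; apply/negP => yr.
pose m := (opnorm y)^-1; have m0 : 0 < m by rewrite invr_gt0.
have mr : m < r by rewrite -[r]invrK ltf_pV2 ?posrE // invr_gt0.
have nm : opnorm y * m = 1 by rewrite mulfV // gt_eqF.
have yinv : has_inverse y by exists x.
(* [N - k y = - N y (r + k / N - a)] for [k = 1] and [k = - 1]. *)
have fac (k : R) : r + k * m != 0 -> `|r + k * m| < r *+ 2 ->
    has_inverse ((opnorm y)%:C%C *: 1 - k%:C%C *: y).
  move=> k1 k2.
  have -> : (opnorm y)%:C%C *: 1 - k%:C%C *: y =
      (- (opnorm y)%:C%C) *: (y * ((r + k * m)%:C%C *: 1 - a)).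
    have -> : (r + k * m)%:C%C *: 1 - a = (k * m)%:C%C *: 1 - x.
      by rewrite /x opprB addrA -scalerDl -rmorphD [X in X%:C%C]addrC.
    rewrite mulrBr yx -scalerAr mulr1 scalerBr scalerA mulNr -rmorphM /=.
    by rewrite mulrCA nm mulr1 !scaleNr opprK addrC.
  apply: has_inverseZ; first by rewrite oppr_eq0 eq_complex /= gt_eqF.
  apply: has_inverseM => //; apply: gap; first by rewrite eq_complex /= negb_and k1.
  by rewrite -ltcR -normr_normc normc_def /= expr0n addr0 sqrtr_sqr ltcR.
have pyy : pos (y * y) by rewrite -{1}sy; apply: pos_star.
have nyy : opnorm (y * y) = opnorm y * opnorm y.
  by rewrite -{2}sy (opnorm_Cstar hdot) expr2.
apply: (norm_in_spectrum hdot pyy).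
  apply: contraTneq n0 => yy0; have := nyy; rewrite yy0 (bnorm0 hN) => /eqP.
  by rewrite eq_sym mulf_eq0 orbb => /eqP ->; rewrite ltxx.
have -> : (opnorm (y * y))%:C%C *: 1 - y * y =
    ((opnorm y)%:C%C *: 1 - 1%:C%C *: y) * ((opnorm y)%:C%C *: 1 - (-1)%:C%C *: y).
  rewrite nyy rmorphM -scalerA rmorphN1 rmorph1 scale1r scaleN1r opprK.
  rewrite mulrDr !mulrBl -!scalerAl -!scalerAr !mul1r !mulr1 addrA.
  by rewrite subrK.
apply: has_inverseM; apply: fac.
- by rewrite gt_eqF // mul1r addr_gt0.
- by rewrite mul1r gtr0_norm ?addr_gt0 // mulr2n ltrD2l.
- by rewrite gt_eqF // mulN1r subr_gt0.
- rewrite mulN1r gtr0_norm ?subr_gt0 // mulr2n; lra.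
Qed.

(** The support projection is [(1 + u) / 2] for the sign [u = x |x|^-1] of
    [x = a - r]: the gap of the spectrum of [a] between [0] and [2 r] makes
    [|x| >= r], so that [a] vanishes where [x = - |x|]. *)
Lemma support_projection a (r : R) : 0 < r -> pos a ->
  (forall l : R[i], l != 0 -> normc l < r *+ 2 -> has_inverse (l *: 1 - a)) ->
  exists p, [/\ star p = p, p * p = p, a * p = a &
    forall h, r * nrm (p h) ^+ 2 <= rdot (a h) h].
Proof.
move=> r0 pa gap; pose x := a - r%:C%C *: 1.
have [y0 y01 y02] : has_inverse (r%:C%C *: 1 - a).
  apply: gap; first by rewrite eq_complex /= gt_eqF.
  by rewrite normcR ?(ltW r0) // mulr2n ltrDl.
pose y := - y0.
have xy : x * y = 1 by rewrite /x /y mulrN -mulNr opprB.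
have yx : y * x = 1 by rewrite /x /y mulNr -mulrN opprB.
have ny : opnorm y <= r^-1 by apply: inverse_norm_le pa gap xy yx.
have sx : star x = x by rewrite starB // starZr // star1 // pa.1.
have aE : a = x + r%:C%C *: 1 by rewrite /x subrK.
clearbody y x; have [e [pe ee ec]] := self_abs hdot sx.
have xe : x * e = e * x by apply: ec.
have ye : y * e = e * y by apply: ec; rewrite xy yx.
pose f := e * y * y.
have ef : e * f = 1 by rewrite /f !mulrA ee -(mulrA x) xy mulr1 xy.
have fe : f * e = 1.
  have -> : f * e = e * (y * (y * e)) by rewrite /f !mulrA.
  by rewrite ye (mulrA y) ye -[RHS]ef /f !mulrA.
have nf : opnorm f <= r^-1.
  apply: opnorm_le => [|h]; first by rewrite invr_ge0 ltW.
  have {1}-> : f h = y (x (f h)) by rewrite -opME yx.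
  apply: le_trans (opnormP _ _) _; apply: ler_pM => //.
    exact: opnorm_ge0.
    exact: nrm_ge0.
  have : nrm (x (f h)) ^+ 2 = nrm h ^+ 2.
    rewrite -!(rdotxx hdot) rstarP sx -opME -ee opME -{1}pe.1 -rstarP.
    by rewrite -opME ef.
  by move/eqP; rewrite eqrXn2 ?nrm_ge0 // => /eqP ->.
clearbody f; have [pf eq1] := inverse_coercive hdot pe ef fe.
have er v : r * nrm v ^+ 2 <= rdot (e v) v.
  rewrite -ler_pdivlMl //; apply: le_trans (eq1 v) _.
  by rewrite ler_wpM2r // pe.2.
pose q := e - x.
have aq : a * q = 0.
  apply: op_ext => h; rewrite opME op0E; apply: (pos_quad0 hdot) => //.
  apply/le_anti; rewrite pa.2 andbT.
  have -> : a (q h) = r%:C%C *: q h - e (q h).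
    rewrite -[X in _ - X]opME -[a (q h)]opME aE mulrDl.
    have -> : x * q = - (e * q) by rewrite /q !mulrBr ee xe opprB.
    by rewrite -scalerAl mul1r opDE opNE opZE addrC.
  by rewrite rdotBl rdotZl (rdotxx hdot) subr_le0 er.
have xf : x * f = f * x.
  have -> : f * x = f * e * x * f by rewrite -(mulrA f e) -xe -!mulrA ef mulr1.
  by rewrite fe mul1r.
pose u := x * f.
have su : star u = u by rewrite /u starM // pf.1 sx -xf.
have uu : u * u = 1.
  have -> : u * u = x * (f * x) * f by rewrite /u !mulrA.
  rewrite -xf !mulrA -ee -(mulrA e e). by rewrite ef mulr1 ef.
have qf : q * f = 1 - u by rewrite /q mulrBl ef.
pose hf : R[i] := 2^-1.
have hh : hf + hf = 1 by rewrite -mulr2n -(mulr_natr hf) mulVf // pnatr_eq0.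
have shf : hf^*%C = hf.
  by rewrite /hf -(rmorph_nat (real_complex R)) -fmorphV /= oppr0.
pose p := hf *: (1 + u).
have ap : a * p = a.
  have -> : p = 1 - hf *: (q * f).
    rewrite qf /p scalerDr scalerBr opprB -[X in _ = X + _]scale1r -hh scalerDl.
    by rewrite [RHS]addrC [RHS]addrA subrK addrC.
  by rewrite mulrBr -scalerAr mulrA aq mul0r scaler0 subr0 mulr1.
have sp : star p = p by rewrite starZ // shf starD // star1 // su.
have pa' : p * a = a by rewrite -pa.1 -{1}sp -starM // pa.1 ap pa.1.
have pp : p * p = p.
  rewrite {1}/p -scalerAl mulrDl mul1r.
  have -> : u * p = p by rewrite /p -scalerAr mulrDr mulr1 uu addrC.
  by rewrite -mulr2n -scaler_nat scalerA /hf mulVf ?scale1r // pnatr_eq0.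
exists p; split=> // h.
have xp : x * p = e * p.
  rewrite /p -!scalerAr !mulrDr !mulr1; congr (_ *: _).
  have -> : x * u = e by rewrite /u mulrA -ee -mulrA ef mulr1.
  have -> : e * u = x by rewrite /u mulrA -xe -mulrA ef mulr1.
  by rewrite addrC.
have {1}-> : a = p * (e * p + r%:C%C *: p).
  by rewrite -xp -[X in _ *: X]mul1r scalerAl -mulrDl -aE ap pa'.
rewrite opME rstarP sp opDE opZE opME rdotDl rdotZl (rdotxx hdot) lerDr.
exact: pe.2.
Qed.

End Support.

(** * Spectra relative to a positive element *)

Section ASpectrum.
Context {R : realType} {H : completeNormedModType R[i]}.
Context {dot : {dot H for Num.conj}} {M : set (H -> H)}.
Context {hM : von_neumann_algebra dot M} {ne : (idfun : H -> H) <> 0}.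
Hypothesis hdot : induces_norm dot.
Local Notation B := (op hM ne).
Local Notation rdot := (rdot dot).
Implicit Types (v w x y z : B) (h k : H) (l : R[i]).
Let hN := opnorm_banach hM ne hdot.

(** As [0] lies outside the closed set of nonzero spectral values, a whole disc
    around it does. *)
Lemma spectral_gap (a : B) : well_supported M a ->
  exists2 r : R, 0 < r &
    forall l, l != 0 -> normc l < r *+ 2 -> has_inverse (l *: 1 - a).
Proof.
rewrite /well_supported -openC openE => /(_ 0) [|e /= e0 ball_e].
  by move=> [_ /= /(_ erefl)].
have [d d0 dE] : exists2 d : R, 0 < d & e = d%:C%C.
  exists (complex.Re e); last by rewrite RRe_real // gtr0_real.
  by move: e0; rewrite ltcE => /andP[].
exists (d / 2); first by rewrite divr_gt0.
move=> l l0; rewrite -(mulr_natr (d / 2)) divfK // => ld.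
have : ~ spectrum M a l.
  have : ball_ [eta Num.norm] (0 : R[i]^o) e l.
    by rewrite /ball_ /= sub0r normrN dE normr_normc ltcR.
  by move=> /ball_e /= h s; apply: h; split=> // /eqP; apply/negP.
move=> /contrapT[S MS [S1 S2]].
exists (Op hM ne MS); apply: op_ext => h.
  exact: (congr1 (fun f : H -> H => f h) S1).
exact: (congr1 (fun f : H -> H => f h) S2).
Qed.

Variables (a p : B) (r : R).
Hypotheses (r0 : 0 < r) (pa : pos a) (a0 : a != 0).
Hypotheses (pp : p * p = p) (ap : a * p = a).
Hypothesis a_ge : forall h, r * nrm (p h) ^+ 2 <= rdot (a h) h.

(** [A] and its support projection have the same kernel. *)
Lemma support_eq0 w : a * w = 0 <-> p * w = 0.
Proof.
split=> [aw|pw]; last by rewrite -ap -mulrA pw mulr0.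
apply: op_ext => h; apply/nrm_eq0/eqP; rewrite -sqrf_eq0; apply/eqP/le_anti.
rewrite sqr_ge0 andbT -(pmulr_rle0 _ r0) (le_trans (a_ge (w h))) //.
by rewrite -opME aw op0E /rdot linear0l.
Qed.

Lemma support_eq v w : a * v = a * w <-> p * v = p * w.
Proof.
split=> /eqP; rewrite -subr_eq0 -mulrBr => /eqP/support_eq0/eqP;
  by rewrite mulrBr subr_eq0 => /eqP.
Qed.

Lemma support_neq0 : p != 0.
Proof. by apply: contra_neq a0 => p0; rewrite -ap p0 mulr0. Qed.

Lemma vec_seminormE h : vec_seminorm dot a h = Num.sqrt (rdot (a h) h).
Proof. by []. Qed.

Definition corner_stable x := p * x = p * x * p.

(** For [a k = 0] and [h0] of seminorm [1], all [h0 + c k] have seminorm [1],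
    and the bounded quadratic polynomial [<a x (h0 + c k), x (h0 + c k)>] in the
    real number [c] has leading coefficient [0]. Conversely the seminorm is
    equivalent to [|p h|]. *)
Lemma Abounded_stable x : Abounded dot M a x <-> corner_stable x.
Proof.
split=> [[_ xb]|px].
  have [h0 h01] : exists h, rdot (a h) h = 1.
    have [h ah] : exists h, 0 < rdot (a h) h.
      apply: contrapT => /forallNP all0; case/eqP: a0; apply: (self_quad0 hdot).
        exact: pa.1.
      by move=> h; apply/le_anti; rewrite pa.2 andbT leNgt; apply/negP; exact: all0.
    pose c := (Num.sqrt (rdot (a h) h))^-1.
    exists (c%:C%C *: h); rewrite linearZ /= rdotZl rdotZr mulrA -invfM -expr2.
    by rewrite sqr_sqrtr ?ltW // mulVf // gt_eqF.
  suff : p * (x * (1 - p)) = 0.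
    by rewrite mulrBr mulr1 mulrBr mulrA => /eqP; rewrite subr_eq0 => /eqP.
  apply: op_ext => h; rewrite opME opME; set k := (1 - p) h.
  have ak : a k = 0 by rewrite /k -opME mulrBr mulr1 ap subrr.
  pose K := op_seminorm dot a x.
  have [C C0 KC] : exists2 C : R, 0 <= C & forall c : R,
      rdot (a (x (h0 + c%:C%C *: k))) (x (h0 + c%:C%C *: k)) <= C.
    have vb c : ((vec_seminorm dot a (x (h0 + c%:C%C *: k)))%:E <= K)%E.
      apply: ereal_sup_ubound; exists (h0 + c%:C%C *: k) => //=.
      rewrite vec_seminormE linearD linearZ /= ak scaler0 addr0 rdotDr h01.
      by rewrite rdotZr rstarP pa.1 ak rdotC /rdot linear0l /= mulr0 addr0 sqrtr1.
    have Kfin : K \is a fin_num.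
      rewrite ge0_fin_numE //; apply: le_trans (vb 0).
      by rewrite lee_fin sqrtr_ge0.
    exists (fine K ^+ 2) => [|c]; first exact: sqr_ge0.
    have := vb c; rewrite -(fineK Kfin) lee_fin vec_seminormE => vc.
    rewrite -[leLHS]sqr_sqrtr ?pa.2 //.
    by rewrite ler_sqr ?nnegrE ?sqrtr_ge0 // (le_trans _ vc) ?sqrtr_ge0.
  set u := x h0; set v := x k.
  have quad (c : R) : rdot (a u) u + c ^+ 2 * rdot (a v) v <= C.
    have ex (t : R) : rdot (a (x (h0 + t%:C%C *: k))) (x (h0 + t%:C%C *: k)) =
        rdot (a u) u + 2 * t * rdot (a u) v + t ^+ 2 * rdot (a v) v.
      rewrite [opf x _]linearD /= [opf x (_ *: _)]linearZ /= -/u -/v.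
      rewrite [opf a _]linearD /= [opf a (_ *: _)]linearZ /=.
      rewrite rdotDl !rdotDr !rdotZl !rdotZr [rdot (a v) u]rstarP pa.1.
      by rewrite [rdot v _]rdotC; ring.
    have := KC c; have := KC (- c); rewrite !ex sqrrN; lra.
  have av : rdot (a v) v = 0.
    apply/le_anti; rewrite pa.2 andbT leNgt; apply/negP => av.
    have cE : (C + 1) / rdot (a v) v * rdot (a v) v = C + 1 by rewrite divfK // gt_eqF.
    have c0 : 0 <= (C + 1) / rdot (a v) v.
      by apply: divr_ge0; [rewrite addr_ge0 | exact: ltW].
    have := quad (1 + (C + 1) / rdot (a v) v); have := pa.2 u.
    set c := _ / _ in cE c0 *; have := mulr_ge0 c0 c0; nra.
  apply/nrm_eq0/eqP; rewrite -sqrf_eq0; apply/eqP/le_anti.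
  by rewrite sqr_ge0 andbT -(pmulr_rle0 _ r0) -av a_ge.
split; first exact: opP.
pose C := opnorm a * opnorm (p * x) ^+ 2 / r.
apply: (@le_lt_trans _ _ (Num.sqrt C)%:E); last exact: ltry.
apply: ge_ereal_sup => _ [h /= h1 <-]; rewrite lee_fin !vec_seminormE.
apply: ler_wsqrtr; set w := (p * x) (p h).
have wE : p (x h) = w by rewrite -[LHS]opME px.
have -> : rdot (a (x h)) (x h) = rdot (a w) w.
  have aw : a (x h) = a w by rewrite -wE -[a (p _)]opME ap.
  by rewrite aw rstarP pa.1 aw rdotC.
have h2 : rdot (a h) h = 1.
  by rewrite -(sqr_sqrtr (pa.2 h)) -[Num.sqrt _]/(vec_seminorm dot a h) h1 expr1n.
have ph : nrm (p h) ^+ 2 <= r^-1 by have := a_ge h; rewrite h2 -ler_pdivlMl // mulr1.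
apply: le_trans (ler_norm _) _; apply: le_trans (rdot_le hdot _ _) _.
apply: le_trans (_ : opnorm a * nrm w ^+ 2 <= _).
  by rewrite expr2 mulrA ler_wpM2r ?nrm_ge0 ?opnormP.
rewrite /C -mulrA ler_wpM2l ?opnorm_ge0 //.
apply: le_trans (_ : (opnorm (p * x) * nrm (p h)) ^+ 2 <= _).
  by rewrite ler_sqr ?nnegrE ?mulr_ge0 ?opnorm_ge0 ?nrm_ge0 ?opnormP.
by rewrite exprMn ler_wpM2l ?sqr_ge0.
Qed.

Lemma stable_mul x y : corner_stable x -> corner_stable y -> corner_stable (x * y).
Proof.
rewrite /corner_stable => px py.
have -> : p * (x * y) = p * x * (p * y) by rewrite mulrA {1}px -mulrA.
by rewrite {1}py mulrA.
Qed.

Lemma Ainvertible_stable y :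
  Ainvertible dot M a y <->
  exists v, [/\ corner_stable v, p * y * v = p & p * v * y = p].
Proof.
split=> [[f fb [e1 e2]]|[v [pv e1 e2]]].
  have [Mf _] := fb; exists (Op hM ne Mf); split.
  - exact/Abounded_stable.
  - rewrite -mulrA -[RHS]mulr1; apply/support_eq; rewrite mulr1.
    by apply: op_ext => h; exact: (congr1 (fun g : H -> H => g h) e1).
  rewrite -mulrA -[RHS]mulr1; apply/support_eq; rewrite mulr1.
  by apply: op_ext => h; exact: (congr1 (fun g : H -> H => g h) e2).
exists v; first exact/Abounded_stable.
have f1 : a * (y * v) = a by rewrite -[RHS]mulr1; apply/support_eq; rewrite mulr1 mulrA.
have f2 : a * (v * y) = a by rewrite -[RHS]mulr1; apply/support_eq; rewrite mulr1 mulrA.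
by split; [rewrite -{2}f1 | rewrite -{2}f2].
Qed.

(** An inverse [v] in the corner extends to the inverse [p v p + (1 - p) / l],
    as [p y] vanishes on the complement of the corner. *)
Lemma Ainvertible_corner y l : l != 0 -> corner_stable y ->
  Ainvertible dot M a (l *: idfun - opf y) <-> has_inverse (l *: 1 - p * y).
Proof.
move=> l0 py; rewrite -[l *: idfun - _]/(opf (l *: 1 - y)).
apply: iff_trans (Ainvertible_stable _) _.
have cp : p * y * p = p * y by [].
have pc : p * (p * y) = p * y by rewrite mulrA pp.
have pE : p * (l *: 1 - y) = p * (l *: 1 - p * y) by rewrite !mulrBr pc.
set D := l *: 1 - p * y in pE *.
have pD : p * D = l *: p - p * y by rewrite mulrBr -scalerAr mulr1 pc.
have Dp : D * p = l *: p - p * y by rewrite mulrBl -scalerAl mul1r cp.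
split=> [[v [pv e1 e2]]|[v e1 e2]].
  have DDp : D - (l *: p - p * y) = l *: (1 - p).
    by rewrite /D opprB addrA subrK scalerBr.
  rewrite pE in e1; exists (p * v * p + l^-1 *: (1 - p)).
    rewrite mulrDr -scalerAr mulrBr mulr1 Dp DDp scalerA mulVf // scale1r.
    by rewrite !mulrA Dp -pD e1 pp addrC subrK.
  rewrite mulrDl -scalerAl mulrBl mul1r pD DDp scalerA mulVf // scale1r.
  rewrite -(mulrA (p * v)) -pE mulrA.
  have -> : p * v * p = p * v by [].
  by rewrite e2 addrC subrK.
have vp : v * p = p * v.
  by rewrite -[LHS]mulr1 -e1 !mulrA -(mulrA v) pD -Dp mulrA e2 mul1r.
exists v; split; first by rewrite /corner_stable -mulrA vp mulrA pp.
  by rewrite pE -mulrA e1 mulr1.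
by rewrite -vp -mulrA pE pD -Dp mulrA e2 mul1r.
Qed.

Lemma radius_ge y l : Aspectrum dot M a y l ->
  ((normc l)%:E <= Aspectral_radius dot M a y)%E.
Proof. by move=> yl; apply: ereal_sup_ubound; exists l. Qed.

Lemma corner_radius_ge y (c : R) : corner_stable y -> 0 < c ->
  ~ has_inverse (c%:C%C *: 1 - p * y) -> (c%:E <= Aspectral_radius dot M a y)%E.
Proof.
move=> py c0 ninv; have cC : c%:C%C != 0 :> R[i] by rewrite eq_complex /= gt_eqF.
rewrite -(normcR (ltW c0)); apply: radius_ge => /(Ainvertible_corner cC py).
exact: ninv.
Qed.

Lemma corner_radius_le y (c : R) : corner_stable y -> 0 <= c ->
  (forall l, c < normc l -> has_inverse (l *: 1 - p * y)) ->
  (Aspectral_radius dot M a y <= c%:E)%E.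
Proof.
move=> py c0 inv; apply: ge_ereal_sup => _ [l /= yl <-]; rewrite lee_fin.
rewrite leNgt; apply/negP => cl; apply: yl.
have l0 : l != 0.
  by apply: contraTneq cl => ->; rewrite ComplexField.Normc.normc0 -leNgt.
by apply/(Ainvertible_corner l0 py); apply: inv.
Qed.

(** If [0] is not in the [A]-spectrum, the corner element [p y] is invertible
    in the corner and Gelfand's theorem provides a nonzero spectral value. *)
Lemma Aspectrum_nonempty y : corner_stable y -> exists l, Aspectrum dot M a y l.
Proof.
move=> py; have cp : p * y * p = p * y by [].
case: (pselect (Aspectrum dot M a y 0)) => [|/contrapT]; first by exists 0.
rewrite scale0r -[0 - _]/(opf (0 - y)) sub0r.
move=> /Ainvertible_stable[v [pv e1 _]].
have [l l0 ninv] : exists2 l, l != 0 & ~ has_inverse (l *: 1 - p * y).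
  apply: (corner_spectrum_nonempty hN (v := - (p * v * p))) support_neq0 pp _ _.
    by rewrite mulrN !mulrA cp -mulNr; rewrite mulrN mulNr in e1; rewrite e1 pp.
  by rewrite mulrN !mulrA pp.
by exists l => /(Ainvertible_corner l0 py).
Qed.

Lemma Aspectral_radius_ge0 y : corner_stable y ->
  (0%:E <= Aspectral_radius dot M a y)%E.
Proof.
move=> /Aspectrum_nonempty[l /radius_ge]; apply: le_trans.
by rewrite lee_fin normc_ge0.
Qed.

Lemma corner_inverse_swap s z y w l : corner_stable s -> l != 0 ->
  has_inverse (l *: 1 - p * (s * (p * y * w * z * p))) <->
  has_inverse (l *: 1 - z * (p * s * p) * y * w).
Proof.
move=> ps l0.
have -> : p * (s * (p * y * w * z * p)) = (p * s * p * y * w) * (z * p).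
  by rewrite !mulrA.
have -> : z * (p * s * p) * y * w = (z * p) * (p * s * p * y * w).
  by rewrite !mulrA -(mulrA z p p) pp.
by split; apply: has_inverse_swap.
Qed.

(** Test the spectral inequality on [X = p y w z p] with
    [w = (z s y)^*]: up to [0], the spectra of [S X] and [T X] are those of
    [z s y w], whose norm [N (z s y) ^ 2] is a spectral value, and of [z t y w]. *)
Lemma radius_domination s t : corner_stable s -> corner_stable t ->
  (forall x, corner_stable x -> (Aspectral_radius dot M a (s * x)%R <=
     Aspectral_radius dot M a (t * x)%R)%E) ->
  forall z y, opnorm (z * (p * s * p) * y) <= opnorm (z * (p * t * p) * y).
Proof.
move=> ps pt st z y; set b := z * (p * s * p) * y.
have [->|b0] := eqVneq b 0; first by rewrite (bnorm0 hN) opnorm_ge0.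
have n0 : 0 < opnorm b.
  by rewrite lt_def opnorm_ge0 andbT; apply: contra_neq b0; apply: opnorm_eq0.
pose x := p * y * star b * z * p.
have px : corner_stable x by rewrite /corner_stable /x !mulrA pp -!mulrA pp.
have bb : pos (b * star b) by rewrite -{1}(starK hdot b); apply: pos_star.
have nbb := opnorm_Cstar hdot b.
have bb0 : b * star b != 0.
  apply: contraTneq n0 => bb0; move: nbb; rewrite bb0 (bnorm0 hN) => /eqP.
  by rewrite eq_sym sqrf_eq0 => /eqP ->; rewrite ltxx.
have lo : ((opnorm b ^+ 2)%:E <= Aspectral_radius dot M a (s * x)%R)%E.
  apply: corner_radius_ge; [exact: stable_mul | by rewrite exprn_gt0 |].
  move=> /corner_inverse_swap -/(_ ps) h; apply: (norm_in_spectrum hdot bb bb0).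
  by rewrite nbb; apply: h; rewrite eq_complex /= gt_eqF ?exprn_gt0.
have hi : (Aspectral_radius dot M a (t * x)%R <=
    (opnorm (z * (p * t * p) * y) * opnorm b)%:E)%E.
  apply: corner_radius_le; first exact: stable_mul.
    by rewrite mulr_ge0 ?opnorm_ge0.
  move=> l cl; have l0 : l != 0.
    apply: contraTneq cl => ->; rewrite ComplexField.Normc.normc0 -leNgt.
    by rewrite mulr_ge0 ?opnorm_ge0.
  apply/(corner_inverse_swap _ _ _ pt l0); apply: (neumann hN).
  apply: le_lt_trans cl; apply: le_trans (bnormM hN _ _) _.
  by rewrite opnorm_star.
have := le_trans lo (le_trans (st x px) hi).
by rewrite lee_fin expr2 ler_pM2r.
Qed.

(** The spectral value [m] of [s x] gives the spectral value [m / l] of [t x].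
    The value [m = 0] is covered by nonemptiness of the spectrum of [t x]; it is
    the only one if [l = 0]. *)
Lemma radius_le_of_multiple s t x (l : R[i]) : corner_stable s ->
  corner_stable t -> corner_stable x -> normc l <= 1 -> a * s = l *: (a * t) ->
  (Aspectral_radius dot M a (s * x)%R <= Aspectral_radius dot M a (t * x)%R)%E.
Proof.
move=> ps pt px l1 ast; have tx := stable_mul pt px; have sx := stable_mul ps px.
have pst : p * s = l *: (p * t).
  by rewrite scalerAr; apply/support_eq; rewrite -scalerAr.
apply: ge_ereal_sup => _ [m sm <-].
have [->|m0] := eqVneq m 0.
  rewrite -[complex.Re _]/(normc 0) ComplexField.Normc.normc0.
  exact: Aspectral_radius_ge0.
have l0 : l != 0.
  apply/eqP => l0; apply: sm; apply/(Ainvertible_corner m0 sx).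
  rewrite mulrA pst l0 scale0r mul0r subr0; apply: has_inverseZ => //.
  by exists 1; rewrite mulr1.
apply: le_trans (_ : (normc (m / l))%:E <= _)%E.
  rewrite lee_fin -[complex.Re _]/(normc m) ComplexField.Normc.normcM.
  rewrite ComplexField.Normc.normcV ler_pdivlMr ?ler_piMr ?normc_ge0 //.
  rewrite lt_def normc_ge0 andbT; apply: contra_neq l0.
  exact: ComplexField.Normc.eq0_normc.
apply: radius_ge => tm; apply: sm.
have ml : m / l != 0 by rewrite mulf_neq0 // invr_eq0.
apply/(Ainvertible_corner m0 sx); rewrite mulrA pst.
have -> : m *: 1 - l *: (p * t) * x = l *: ((m / l) *: 1 - p * (t * x)).
  by rewrite scalerBr scalerA mulrCA mulfV // mulr1 -scalerAl mulrA.
by apply: has_inverseZ => //; apply/(Ainvertible_corner ml tx).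
Qed.

End ASpectrum.

Theorem theorem3p5 (R : realType) (H : completeNormedModType R[i])
    (dot : {dot H for Num.conj}) (hdot : induces_norm dot)
    (M : set (H -> H)) (hM : von_neumann_algebra dot M)
    (hprime : prime_algebra M)
    (A : H -> H) (hA : M A) (hA0 : A <> 0)
    (hApos : positive_operator dot A) (hAws : well_supported M A)
    (S T : H -> H) (hS : Abounded dot M A S) (hT : Abounded dot M A T) :
  (forall X : H -> H, Abounded dot M A X ->
     (Aspectral_radius dot M A (S \o X) <=
      Aspectral_radius dot M A (T \o X))%E)
  <->
  (exists alpha : R[i], `|alpha| <= 1 /\ A \o S = alpha *: (A \o T)).
Proof.
have ne : (idfun : H -> H) <> 0.
  move=> id0; apply: hA0; apply/funext => h.
  have [lin _] := vna_bounded hM hA.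
  have -> : h = 0 by exact: (congr1 (fun f : H -> H => f h) id0).
  by have := lin (-1) 0 0; rewrite scaler0 add0r scaleN1r addNr.
pose a : op hM ne := Op hM ne hA.
have [MS _] := hS; have [MT _] := hT.
pose s : op hM ne := Op hM ne MS; pose t : op hM ne := Op hM ne MT.
have a0 : a != 0 by apply/eqP => e; apply: hA0; exact: (congr1 (@opf _ _ _ _ hM ne) e).
have pa : pos a by apply: pos_of_positive_operator.
have [r r0 gap] := spectral_gap (a := a) hAws.
have [p [_ pp ap a_ge]] := support_projection hdot r0 pa gap.
have stable := Abounded_stable hdot r0 pa a0 ap a_ge.
have ps : corner_stable p s by apply/stable.
have pt : corner_stable p t by apply/stable.
have hp (x y : op hM ne) : (forall m, x * m * y = 0) -> x = 0 \/ y = 0.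
  move=> xy; have [m Mm|e|e] := hprime x y (opP x) (opP y).
  - exact: (congr1 (@opf _ _ _ _ hM ne) (xy (Op hM ne Mm))).
  - by left; apply: op_ext => h; rewrite e.
  - by right; apply: op_ext => h; rewrite e.
split=> [rad|[l [l1 asl]] X hX]; last first.
  have [MX _] := hX; pose x : op hM ne := Op hM ne MX.
  apply: (@radius_le_of_multiple _ _ _ _ hM ne hdot a p r r0 pa a0 pp ap a_ge
    s t x l) => //.
  - exact/stable.
  - by rewrite -lecR -normr_normc.
  - by apply: op_ext => h; exact: (congr1 (fun f : H -> H => f h) asl).
have dom := radius_domination hdot r0 pa a0 pp ap a_ge ps pt.
have [|l [l1 stl]] := dominated_proportional hdot hp (s := p * s * p) (t := p * t * p).
  by apply: dom => x /stable hx; exact: rad.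
exists l; split; first by rewrite normr_normc lecR.
have : a * s = l *: (a * t).
  rewrite scalerAr; apply/(support_eq r0 ap a_ge).
  by rewrite ps stl -pt scalerAr.
exact: (congr1 (@opf _ _ _ _ hM ne)).
Qed.
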